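(* Let $f$ satisfy the assumption (A1) stated in the context. Given $c>c^*$, let $u=u(x_1,x_2)$, with values in $[0,1]$, be a solution to $$f(u)+c\,u_{x_1}+\Delta u-z=0\qquad\text{on } \mathbb{R}\times\,]0,1[,$$ $$u_{x_2}(x_1,0)=u_{x_2}(x_1,1)=0\quad\text{for all } x_1\in\mathbb{R},$$ $$\lim_{x_1\to-\infty}u(x_1,x_2)=0,\qquad \lim_{x_1\to+\infty}u(x_1,x_2)=1,$$ for some nonnegative smooth function $z=z(x_1,x_2)$. Then $$\|z\|_{L^1}=\int_{\mathbb{R}\times[0,1]}|z(x)|\,dx\ \ge\ C_{min},$$ where $C_{min}$ is the minimum cost for the corresponding 1-dimensional problem with the same speed $c$.
   Context: Assumption (A1) (monostable): $f\in C^2$, $f(0)=f(1)=0$, and $f''(u)<0$ for all $u\in[0,1]$. Under (A1), $c^*<0$ is the number such that there exists $U:\mathbb{R}\to[0,1]$ with $U''+cU'+f(U)=0$, $U(-\infty)=0$, $U(+\infty)=1$ for every speed $c\le c^*$ and for no speed $c>c^*$. The 1-dimensional problem: $\mathcal{M}_c$ denotes the set of all positive, bounded Radon measures $\mu$ on $\mathbb{R}$ such that $U''+cU'+f(U)=\mu$, $U(-\infty)=0$, $U(+\infty)=1$ has a monotonically increasing (i.e. nondecreasing) solution $U$ (equation in the sense of measures), and $$C_{min}=\min_{\mu\in\mathcal{M}_c}\mu(\mathbb{R}).$$ The minimum is attained by the profile with $U(x)=0$ for $x\le0$, $U''+cU'+f(U)=0$ for $x>0$, $\lim_{x\to+\infty}U(x)=1$,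 whose measure is a point mass at the origin, so that $C_{min}=U'(0+)-U'(0-)=U'(0+)$. *)

(* Defs.v *)
From HB Require Import structures.
From mathcomp Require Import all_boot all_order ssralg ssrnum ssrint interval.
From mathcomp Require Import all_classical all_reals all_analysis.

Set Implicit Arguments.
Unset Strict Implicit.
Unset Printing Implicit Defensive.

Import Order.TTheory GRing.Theory Num.Theory.
Import numFieldNormedType.Exports.

Local Open Scope ring_scope.
Local Open Scope classical_set_scope.

Section OneD.
Variable R : realType.
Implicit Types (f U phi : R -> R) (c : R).

Definition C2 f : Prop :=
  [/\ forall x, derivable f x 1, forall x, derivable f^`() x 1
    & continuous f^`(2)].

Definition smooth phi : Prop := forall (n : nat) (x : R), derivable phi^`(n) x 1.

Definition test_function phi : Prop :=
  smooth phi /\ exists A : R, forall x, A < `|x| -> phi x = 0.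

(* Only the values of [f] on [[0, 1]] play a role; [C2] is required on the
   whole line because every C^2 function on [[0, 1]] extends to one. *)
Definition monostable f : Prop :=
  [/\ C2 f, f 0 = 0, f 1 = 0 & forall u, 0 <= u <= 1 -> f^`(2) u < 0].

Definition traveling_profile f c U : Prop :=
  [/\ forall x, 0 <= U x <= 1,
      forall x, derivable U x 1 /\ derivable U^`() x 1,
      forall x, U^`(2) x + c * U^`() x + f (U x) = 0,
      U x @[x --> -oo] --> (0 : R)
    & U x @[x --> +oo] --> (1 : R)].

Definition is_critical_speed f (cstar : R) : Prop :=
  [/\ cstar < 0,
      forall c, c <= cstar -> exists U, traveling_profile f c U
    & forall c, cstar < c -> ~ exists U, traveling_profile f c U].

(* [U'' + c U' + f(U) = mu] in the sense of distributions: derivatives are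
   moved onto the test function, whence the minus sign in front of [c]. *)
Definition solves_in_measures f c U
    (mu : {finite_measure set (measurableTypeR R) -> \bar R}) : Prop :=
  forall phi, test_function phi ->
    (\int[lebesgue_measure]_x
        (U x * phi^`(2) x - c * (U x * phi^`() x) + f (U x) * phi x)%:E
     = \int[mu]_x (phi x)%:E)%E.

(* A positive bounded Radon measure on the line is a finite Borel measure. *)
Definition admissible_measures f c :
    set {finite_measure set (measurableTypeR R) -> \bar R} :=
  [set mu | exists U, [/\ {homo U : x y / x <= y},
                          solves_in_measures f c U mu,
                          U x @[x --> -oo] --> (0 : R)
                        & U x @[x --> +oo] --> (1 : R)]].

(* An infimum in [\bar R], which is the minimum whenever that is attained. *)
Definition C_min f c : \bar R :=
  ereal_inf [set mu [set: R] | mu in admissible_measures f c].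

End OneD.

Definition open_strip {R : realType} : set (R * R) := [set p | 0 < p.2 < 1].
Definition closed_strip {R : realType} : set (R * R) := [set p | 0 <= p.2 <= 1].

Section TwoD.
Variable R : realType.
Implicit Types (u z : R * R -> R) (D : set (R * R)).

Definition e1 : R * R := (1, 0).
Definition e2 : R * R := (0, 1).

Definition d1 u : R * R -> R := fun p => 'D_e1 u p.
Definition d2 u : R * R -> R := fun p => 'D_e2 u p.

Definition laplacian u : R * R -> R := fun p => d1 (d1 u) p + d2 (d2 u) p.

(* [partials [:: b1; ...; bk] u] is the k-th order iterated partial derivative
   of [u], where [false] and [true] stand for the directions x1 and x2. *)
Definition partials (s : seq bool) u : R * R -> R :=
  foldr (fun b v => if b then d2 v else d1 v) u s.

(* To be used with [D] open. *)
Definition Ck_on (k : nat) D u : Prop :=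
  forall s : seq bool, (size s <= k)%N -> forall p, D p ->
    {for p, continuous (partials s u)} /\
    ((size s < k)%N -> derivable (partials s u) p e1 /\
                       derivable (partials s u) p e2).

Definition smooth_on D u : Prop := forall k, Ck_on k D u.

(* C^1 up to the boundary of the strip: [u] is continuous on the closed strip
   and its partial derivatives in the open strip extend continuously to the
   closed one. *)
Definition C1_closed_strip u : Prop :=
  [/\ Ck_on 1 open_strip u,
      {within closed_strip, continuous u}
    & exists v1 v2 : R * R -> R,
      [/\ {within closed_strip, continuous v1},
          {within closed_strip, continuous v2}
        & forall p, open_strip p -> v1 p = d1 u p /\ v2 p = d2 u p]].

(* The derivatives at [x2 = 0] and [x2 = 1] are one-sided, as values of [u]
   outside the strip are irrelevant. *)
Definition neumann u : Prop :=
  forall x1 : R,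
    (h^-1 * (u (x1, h) - u (x1, 0)) @[h --> 0^'+] --> (0 : R)) /\
    (h^-1 * (u (x1, 1 + h) - u (x1, 1)) @[h --> 0^'-] --> (0 : R)).

Definition front_limits u : Prop :=
  forall x2 : R, 0 <= x2 <= 1 ->
    (u (x1, x2) @[x1 --> -oo] --> (0 : R)) /\
    (u (x1, x2) @[x1 --> +oo] --> (1 : R)).

Definition strip_solution (f : R -> R) (c : R) z u : Prop :=
  [/\ Ck_on 2 open_strip u, C1_closed_strip u,
      forall p, open_strip p -> f (u p) + c * d1 u p + laplacian u p - z p = 0
    & neumann u].

(* smooth in the open strip and continuous up to its boundary *)
Definition smooth_source z : Prop :=
  smooth_on open_strip z /\ {within closed_strip, continuous z}.

End TwoD.

(* Main.v *)
Require Import Defs.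
From HB Require Import structures.
From mathcomp Require Import all_boot all_order ssralg ssrnum ssrint interval.
From mathcomp Require Import all_classical all_reals all_analysis.
From mathcomp Require Import rat measurable_realfun.
From mathcomp Require Import ring lra.

Set Implicit Arguments.
Unset Strict Implicit.
Unset Printing Implicit Defensive.

Import Order.TTheory GRing.Theory Num.Theory.
Import numFieldNormedType.Exports.

Local Open Scope ring_scope.
Local Open Scope classical_set_scope.

(** The proof is a calibration argument.  Call [phi], [B] a calibration when
    [0 <= phi <= 1], [phi' <= 0] and
      [phi f - phi' xi^2 + (c phi + B') xi >= 0]
    on [[0, 1]] for every real [xi].  Multiply the equation by [phi (u)] and use
    this with [xi] the derivative of [u] in [x1]: in the open strip
      [z >= phi (u) z >= d/dx1 (phi (u) u_x1 - B (u)) + d/dx2 (phi (u) u_x2)].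
    Integrate.  The Neumann condition removes the flux in [x2]; the flux
    [phi (u) u_x1] disappears at infinity because its mean over a window of
    width one is the increment of a continuous function of [u], and [u] has limits.
    What is left is [B 0 - B 1], so the integral of [z] is at least [B 0 - B 1] for every
    calibration ([strip_cost_ge]).

    For a large value of [B 0 - B 1], start from a continuous function [k >= 0] and
    take [phi = exp (- \int f k^2)] and [B' = - phi (c + 2 f k)].  The quadratic
    form in [xi] is then [phi f (1 - k xi)^2]: a calibration, which is exact for
    the slope [xi = 1 / k].  If [1 / k] is the slope of a one-dimensional front as
    a function of its height, then [B 0 - B 1] is the slope with which that front
    leaves [0], that is the mass of its point source ([front_calibration]).

    The optimal front reaches [1] with slope [0], where [k] is infinite.  Hence an
    approximation: above a height [s1 < 1] the reaction is replaced by its chord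
    between [s1] and [1].  There the front is an explicit exponential, and from
    [s1] it is continued downwards by a Picard iteration
    ([reversed_front_exists]).  As [f] is concave it lies above the chord, so this
    front solves the equation of [f] with a nonnegative source, of mass
    [O (1 - s1)] ([front_source_mass]).  Either the front reaches [0], where it is
    cut at the price of a point mass which the calibration recovers up to
    [O (1 - s1)], or it stays positive, tends to [0], and needs no point mass at
    all.  In both cases the minimal cost is at most the integral of [z] plus
    [O (1 - s1)] ([C_min_le_cut]); let [s1] tend to [1]. *)

(** * Differential calculus on the line *)

Section Calculus.
Context {R : realType}.
Implicit Types (f g df : R -> R) (a b x : R).

Lemma is_derive_continuous f x l : is_derive x 1 f l -> {for x, continuous f}.
Proof.
by move=> fl; apply/differentiable_continuous/derivable1_diffP; exact: ex_derive.
Qed.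

Lemma within_derive_continuous f df a b :
  (forall x, a <= x <= b -> is_derive x 1 f (df x)) ->
  {within `[a, b], continuous f}.
Proof.
move=> fd; apply: continuous_in_subspaceT => x /set_mem/=.
by rewrite in_itv /= => xab; exact: is_derive_continuous (fd x xab).
Qed.

Lemma MVT_closed f df a b : a < b ->
  (forall x, a <= x <= b -> is_derive x 1 f (df x)) ->
  exists2 c, a < c < b & f b - f a = df c * (b - a).
Proof.
move=> ab fd; have fd' x : x \in `]a, b[%R -> is_derive x 1 f (df x).
  by rewrite in_itv/= => /andP[ax xb]; apply: fd; rewrite !ltW.
have [c cab fE] := MVT ab fd' (within_derive_continuous fd).
by exists c => //; move: cab; rewrite in_itv.
Qed.

Lemma derive_ge0_le f df a b : a <= b ->
  (forall x, a <= x <= b -> is_derive x 1 f (df x)) ->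
  (forall x, a < x < b -> 0 <= df x) -> f a <= f b.
Proof.
rewrite le_eqVlt => /predU1P[-> //|ab] fd df0.
have [x xab fE] := MVT_closed ab fd.
by rewrite -subr_ge0 fE mulr_ge0 ?df0// subr_ge0 ltW.
Qed.

Lemma derive_gt0_lt f df a b : a < b ->
  (forall x, a <= x <= b -> is_derive x 1 f (df x)) ->
  (forall x, a < x < b -> 0 < df x) -> f a < f b.
Proof.
move=> ab fd df0; have [x xab fE] := MVT_closed ab fd.
by rewrite -subr_gt0 fE mulr_gt0 ?df0// subr_gt0.
Qed.

Lemma derive_eq0_eq f df a b : a <= b ->
  (forall x, a <= x <= b -> is_derive x 1 f (df x)) ->
  (forall x, a < x < b -> df x = 0) -> f a = f b.
Proof.
rewrite le_eqVlt => /predU1P[-> //|ab] fd df0.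
have [x xab fE] := MVT_closed ab fd.
by apply/esym/eqP; rewrite -subr_eq0 fE df0// mul0r.
Qed.

(** A mean value inequality in which the bound on the derivative may vary: [g - f]
    and [g + f] are both nondecreasing. *)
Lemma derive_norm_le f df g dg a b : a <= b ->
  (forall x, a <= x <= b -> is_derive x 1 f (df x)) ->
  (forall x, a <= x <= b -> is_derive x 1 g (dg x)) ->
  (forall x, a < x < b -> `|df x| <= dg x) ->
  `|f b - f a| <= g b - g a.
Proof.
move=> ab fd gd fg; rewrite ler_norml; apply/andP; split.
  have : f a + g a <= f b + g b.
    apply: (@derive_ge0_le (f + g) (df + dg) _ _ ab) => x xab.
      by apply: is_deriveD; [exact: fd|exact: gd].
    have := fg _ xab; rewrite ler_norml => /andP[+ _].
    rewrite /GRing.add/=; lra.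
  lra.
have : g a - f a <= g b - f b.
  apply: (@derive_ge0_le (g - f) (dg - df) _ _ ab) => x xab.
    by apply: is_deriveB; [exact: gd|exact: fd].
  have := fg _ xab; rewrite ler_norml => /andP[_ +].
  rewrite !fctE; lra.
lra.
Qed.

Lemma continuous_integrable f a b : continuous f ->
  lebesgue_measure.-integrable `[a, b] (EFin \o f).
Proof.
move=> fc; apply: continuous_compact_integrable; first exact: segment_compact.
exact: continuous_subspaceT.
Qed.

Lemma antiderivative_right f : continuous f ->
  exists F : R -> R, F 0 = 0 /\ forall x, -1 < x -> is_derive x 1 F (f x).
Proof.
move=> fc; pose G x := \int[lebesgue_measure]_(t in `[-1, x]) (f t).
have Gd x : -1 < x -> is_derive x 1 G (f x).
  move=> x1; have [] := @continuous_FTC1_closed R f (-1) x (x + 1) _ _ x1 (fc x).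
  - by rewrite ltrDl.
  - exact: continuous_integrable.
  - by rewrite -/G derive1E => Gd <-; exact/derivableP.
exists (fun x => G x - G 0); split; first by rewrite subrr.
move=> x x1; rewrite -[f x]subr0.
by apply: is_deriveB; exact: Gd.
Qed.

(** An integral with a fixed base point is a primitive only to the right of that
    point.  Two such primitives, one of them reflected, differ by a constant on
    [`]-1, 1[] and are glued there. *)
Lemma antiderivative f : continuous f ->
  exists F : R -> R, F 0 = 0 /\ forall x, is_derive x 1 F (f x).
Proof.
move=> fc; have [A [A0 Ad]] := antiderivative_right fc.
have [|B [B0 Bd]] := @antiderivative_right (f \o -%R).
  by move=> x; apply: continuous_comp; [exact: oppr_continuous|exact: fc].
pose F x := if 0 <= x then A x else - B (- x).
have Bd' x : x < 1 -> is_derive x 1 (fun y => - B (- y)) (f x).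
  move=> x1; have := Bd (- x); rewrite ltrN2 => /(_ x1) /=; rewrite opprK => Bx.
  rewrite (_ : f x = - (f x * -1)); last by rewrite mulrN1 opprK.
  by apply: is_deriveN; apply: (@is_derive1_comp _ B -%R).
have AB x : -1 < x -> x < 1 -> A x = - B (- x).
  move=> x1 x2; suff : A x + B (- x) = 0 by lra.
  have ABd (y : R) : -1 < y < 1 -> is_derive y 1 (fun y : R => A y - (- B (- y))) 0.
    move=> /andP[y1 y2]; rewrite -(subrr (f y)).
    by apply: is_deriveB; [exact: Ad|exact: Bd'].
  have E0 : A 0 - (- B (- 0)) = 0 by rewrite A0 oppr0 B0; lra.
  have [x0|x0] := leP 0 x.
    have xd (y : R) : 0 <= y <= x ->
        is_derive y 1 (fun y : R => A y - (- B (- y))) (cst 0 y).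
      move=> /andP[y1 y2].
      by apply: ABd; rewrite (lt_le_trans _ y1)// (le_lt_trans y2).
    by have := derive_eq0_eq x0 xd (fun _ _ => erefl); rewrite E0 opprK => <-.
  have xd (y : R) : x <= y <= 0 ->
      is_derive y 1 (fun y : R => A y - (- B (- y))) (cst 0 y).
    move=> /andP[y1 y2].
    by apply: ABd; rewrite (lt_le_trans x1 y1)// (le_lt_trans y2).
  have := derive_eq0_eq (ltW x0) xd (fun _ _ => erefl).
  by rewrite E0 opprK => ->.
exists F; split; first by rewrite /F lexx.
move=> x; have [x1|x1] := ltP (-1) x.
  apply: (near_eq_is_derive _ (Ad x x1)).
  near=> y; rewrite /F; case: leP => // y0; apply: AB.
    by near: y; exact: lt_nbhsr.
  by rewrite (lt_trans y0).
apply: (near_eq_is_derive _ (Bd' x _)); last lra.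
near=> y; rewrite /F; case: leP => // y0; suff: y < 0 by rewrite ltNge y0.
by near: y; apply: lt_nbhsl; lra.
Unshelve. all: by end_near. Qed.

(** The next rules are stated for explicit formulas in the variable, so that the
    derivative of a composite expression is obtained by nesting them;
    [is_derive_replace] then leaves an identity between the two derivatives. *)
Lemma is_derive_add f g x a b : is_derive x 1 f a -> is_derive x 1 g b ->
  is_derive x 1 (fun y => f y + g y) (a + b).
Proof. exact: is_deriveD. Qed.

Lemma is_derive_sub f g x a b : is_derive x 1 f a -> is_derive x 1 g b ->
  is_derive x 1 (fun y => f y - g y) (a - b).
Proof. exact: is_deriveB. Qed.

Lemma is_derive_mul f g x a b : is_derive x 1 f a -> is_derive x 1 g b ->
  is_derive x 1 (fun y => f y * g y) (a * g x + f x * b).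
Proof.
move=> fa gb; have := is_deriveM fa gb.
by rewrite addrC [f x *: b]/GRing.scale/= [g x *: a]/GRing.scale/= [g x * a]mulrC.
Qed.

Lemma is_derive_mull f k x a : is_derive x 1 f a ->
  is_derive x 1 (fun y => k * f y) (k * a).
Proof. exact: is_deriveZ. Qed.

Lemma is_derive_replace f x a b : is_derive x 1 f a -> a = b -> is_derive x 1 f b.
Proof. by move=> fa <-. Qed.

End Calculus.

(** * Truncation to an interval *)

Section Clip.
Context {R : realType}.
Implicit Types a b x y : R.

(** Composition with [clip a b] makes a function known on [`[a, b]] into one
    defined on the whole line, with the same continuity. *)
Definition clip a b x := Num.min (Num.max x a) b.

Lemma clip_bounds a b x : a <= b -> a <= clip a b x <= b.
Proof.
move=> ab; apply/andP; rewrite /clip /Num.min /Num.max.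
by case: (ltP x a) => ?; case: ltP => ?; split; lra.
Qed.

Lemma clip_id a b x : a <= x <= b -> clip a b x = x.
Proof. by move=> ab; rewrite /clip /Num.min /Num.max; case: (ltP x a) => ?; case: ltP => ?; lra. Qed.

Lemma clip_le a b x : a <= b -> x <= a -> clip a b x = a.
Proof. by move=> ab xa; rewrite /clip /Num.min /Num.max; case: (ltP x a) => ?; case: ltP => ?; lra. Qed.

Lemma clip_ge a b x : a <= b -> b <= x -> clip a b x = b.
Proof. by move=> ab xa; rewrite /clip /Num.min /Num.max; case: (ltP x a) => ?; case: ltP => ?; lra. Qed.

Lemma clip_nonexpansive a b x y : `|clip a b x - clip a b y| <= `|x - y|.
Proof.
have := ler_norm (x - y); have := ler_norm (- (x - y)); rewrite normrN.
set d := `|x - y| => d1 d2; rewrite /clip /Num.min /Num.max ler_norml.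
by case: (ltP x a) => ?; case: (ltP y a) => ?; case: ltP => ?; case: ltP => ?;
  apply/andP; split; lra.
Qed.

Lemma lipschitz_continuous (F : R -> R) L :
  (forall x y, `|F x - F y| <= L * `|x - y|) -> continuous F.
Proof.
move=> FL; have L0 : 0 <= L.
  by have := FL 1 0; rewrite subr0 normr1 mulr1; apply: le_trans.
move=> x; apply/cvgrPdist_le => e e0; near=> y.
apply: le_trans (FL _ _) _.
have : `|x - y| <= e / (L + 1).
  near: y; apply: cvgr_dist_le; first exact: cvg_id.
  by rewrite divr_gt0// ltr_wpDl.
rewrite ler_pdivlMr ?ltr_wpDl// => h; apply: le_trans h.
by rewrite mulrC ler_wpM2l// lerDl.
Unshelve. all: by end_near. Qed.

Lemma clip_continuous a b : continuous (clip a b).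
Proof.
apply: (@lipschitz_continuous _ 1) => x y; rewrite mul1r.
exact: clip_nonexpansive.
Qed.

End Clip.

(** * A global Picard theorem with prescribed past *)

Section Picard.
Context {R : realType}.
Implicit Types (F V W : R -> R) (c t : R).

Lemma is_derive_expRM c t :
  is_derive t 1 (fun s : R => expR (c * s)) (c * expR (c * t)).
Proof.
have -> : c * expR (c * t) = expR (c * t) * c by rewrite mulrC.
apply: (@is_derive1_comp _ expR (fun s => c * s)).
by rewrite -[X in is_derive _ _ _ X]mulr1; apply: is_deriveZ.
Qed.

Variables (F V0 W0 : R -> R) (L c : R).
Hypothesis FL : forall x y, `|F x - F y| <= L * `|x - y|.
Hypothesis V0d : forall t, is_derive t 1 V0 (W0 t).
Hypothesis W0d : forall t, t <= 0 -> is_derive t 1 W0 (c * W0 t - F (V0 t)).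

Let L0 : 0 <= L.
Proof.
by have := FL 1 0; rewrite subr0 normr1 mulr1; apply: le_trans.
Qed.

Let Fc : continuous F.
Proof. exact: lipschitz_continuous FL. Qed.

(** [V1] solves the equation in which the nonlinear term is frozen at [V]. *)
Let picard_step V V1 := exists W, [/\ V1 0 = V0 0, W 0 = W0 0,
  forall t, is_derive t 1 V1 (W t) &
  forall t, is_derive t 1 W (c * W t - F (V t))].

Let picard_stepP V : exists V1, continuous V -> picard_step V V1.
Proof.
(* A value for every [V] turns the step into a function of [V]. *)
have [Vc|nVc] := pselect (continuous V); last by exists V.
have ec (k : R) : continuous (fun t : R => expR (k * t)).
  by move=> t; exact: (is_derive_continuous (is_derive_expRM k t)).
have [|I [I0 Id]] := @antiderivative _ (fun t => expR (- c * t) * F (V t)).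
  move=> t; apply: cvgM; first exact: ec.
  by apply: continuous_comp; [exact: Vc|exact: Fc].
pose W t := expR (c * t) * (W0 0 - I t).
have Wd t : is_derive t 1 W (c * W t - F (V t)).
  have IW : is_derive t 1 (fun s => W0 0 - I s) (0 - expR (- c * t) * F (V t)).
    by apply: is_derive_sub; exact: Id.
  apply: is_derive_replace (is_derive_mul (is_derive_expRM c t) IW) _; rewrite /W mulNr expRN.
  have : expR (c * t) != 0 by rewrite gt_eqF// expR_gt0.
  by move=> ?; field.
have [|J [J0 Jd]] := @antiderivative _ W.
  by move=> t; exact: (is_derive_continuous (Wd t)).
exists (fun t => V0 0 + J t) => _; exists W; split => //.
- by rewrite J0 addr0.
- by rewrite /W mulr0 expR0 I0 subr0 mul1r.
- by move=> t; rewrite -[W t]add0r; apply: is_deriveD; exact: Jd.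
Qed.

Let step_cont V V1 : picard_step V V1 -> continuous V1.
Proof. by move=> [W [_ _ Vd _]] t; exact: (is_derive_continuous (Vd t)). Qed.

(** The factor [exp (- c t)] absorbs the linear term: only the difference of the
    frozen terms is left. *)
Let is_derive_damped W W' V V' t :
  is_derive t 1 W (c * W t - F (V t)) -> is_derive t 1 W' (c * W' t - F (V' t)) ->
  is_derive t 1 (fun s => expR (- c * s) * (W s - W' s))
    (expR (- c * t) * (F (V' t) - F (V t))).
Proof.
move=> Wd Wd'.
apply: is_derive_replace
  (is_derive_mul (is_derive_expRM (- c) t) (is_derive_sub Wd Wd')) _; ring.
Qed.

(** The prescribed past solves the equation, hence is kept by every step.  All
    iterates agree on [t <= 0], and only [t >= 0] is left to the contraction. *)
Let step_past_deriv V W : W 0 = W0 0 ->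
  (forall t, is_derive t 1 W (c * W t - F (V t))) ->
  (forall t, t <= 0 -> V t = V0 t) -> forall t, t <= 0 -> W t = W0 t.
Proof.
move=> W10 Wd VV0 s s0.
have dd (r : R) : s <= r <= 0 -> is_derive r 1
    (fun s => expR (- c * s) * (W s - W0 s)) (cst 0 r).
  move=> /andP[_ r0].
  apply: is_derive_replace (is_derive_damped (Wd r) (W0d r0)) _.
  by rewrite VV0// subrr mulr0.
have := derive_eq0_eq s0 dd (fun _ _ => erefl).
rewrite W10 subrr mulr0 => /eqP; rewrite mulf_eq0 gt_eqF ?expR_gt0//=.
by rewrite subr_eq0 => /eqP.
Qed.

Let step_past V V1 : picard_step V V1 -> (forall t, t <= 0 -> V t = V0 t) ->
  forall t, t <= 0 -> V1 t = V0 t.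
Proof.
move=> [W [V10 W10 V1d Wd]] VV0 t t0.
have dd (r : R) : t <= r <= 0 -> is_derive r 1 (fun s => V1 s - V0 s) (cst 0 r).
  move=> /andP[_ r0].
  apply: is_derive_replace (is_derive_sub (V1d r) (V0d r)) _.
  by rewrite (step_past_deriv W10 Wd VV0 r0) subrr.
have := derive_eq0_eq t0 dd (fun _ _ => erefl).
by rewrite V10 subrr => /eqP; rewrite subr_eq0 => /eqP.
Qed.

(** The rate of the exponential weight, large enough for [step_contract]. *)
Let M := 1 + `|c| + 2 * L.

Let Mc : 1 + 2 * L <= M - c.
Proof. by have := ler_norm c; rewrite /M; lra. Qed.

Let M1 : 1 <= M.
Proof. by rewrite /M -addrA lerDl addr_ge0// mulr_ge0. Qed.

(** In the norm weighted by [exp (- M t)] each of the two integrations in a step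
    gains a factor of order [1 / M], so that one step halves distances. *)
Let step_contract V V1 U U1 A K : 0 <= K ->
  picard_step V V1 -> picard_step U U1 ->
  (forall t, 0 <= t <= A -> `|V t - U t| <= K * expR (M * t)) ->
  forall t, 0 <= t <= A -> `|V1 t - U1 t| <= K / 2 * expR (M * t).
Proof.
move=> K0 [W [V10 W0E V1d Wd]] [X [U10 X0E U1d Xd]] VU.
have Mc0 : 0 < M - c by have := Mc; have := L0; lra.
have WX s : 0 <= s <= A -> `|W s - X s| <= K / 2 * (M * expR (M * s)).
  move=> /andP[s0 sA].
  pose G r := L * K / (M - c) * expR ((M - c) * r).
  have Gd (r : R) : 0 <= r <= s -> is_derive r 1 G (L * K * expR ((M - c) * r)).
    move=> _; apply: is_derive_replace
      (is_derive_mull (L * K / (M - c)) (is_derive_expRM (M - c) r)) _.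
    rewrite mulrA divfK//.
    by rewrite gt_eqF.
  have := derive_norm_le s0 (fun r _ => is_derive_damped (Wd r) (Xd r)) Gd.
  have bnd (r : R) : 0 < r < s ->
      `|expR (- c * r) * (F (U r) - F (V r))| <= L * K * expR ((M - c) * r).
    move=> /andP[r0 rs]; rewrite normrM gtr0_norm ?expR_gt0// distrC.
    rewrite mulrBl expRB mulNr expRN.
    rewrite [leLHS]mulrC [X in _ <= X]mulrA ler_pM2r ?invr_gt0 ?expR_gt0//.
    apply: le_trans (FL _ _) _; rewrite -mulrA ler_wpM2l// VU//.
    by rewrite ltW//= (le_trans (ltW rs)).
  move=> /(_ bnd); rewrite W0E X0E subrr mulr0 subr0.
  have -> : `|expR (- c * s) * (W s - X s)| = expR (- c * s) * `|W s - X s|.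
    by rewrite normrM gtr0_norm ?expR_gt0.
  move=> h.
  have {}h : expR (- c * s) * `|W s - X s| <= G s.
    apply: le_trans h _; rewrite gerBl /G mulr_ge0 ?expR_ge0//.
    by rewrite divr_ge0 ?mulr_ge0// ltW.
  have : `|W s - X s| <= L * K / (M - c) * expR (M * s).
    rewrite -(@ler_pM2l _ (expR (- c * s))) ?expR_gt0//; apply: le_trans h _.
    rewrite /G mulrBl expRB mulNr expRN le_eqVlt; apply/orP; left; apply/eqP; ring.
  move=> /le_trans; apply.
  rewrite mulrA ler_pM2r ?expR_gt0//.
  rewrite ler_pdivrMr//.
  have LM : L <= M / 2 * (M - c) by have := M1; have := Mc; have := L0; nra.
  by have := ler_wpM2r K0 LM; lra.
move=> t /andP[t0 tA].
have Ed (r : R) : 0 <= r <= t ->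
    is_derive r 1 (fun r => K / 2 * expR (M * r)) (K / 2 * (M * expR (M * r))).
  by move=> _; exact: (is_derive_mull (K / 2) (is_derive_expRM M r)).
have VUd (r : R) : 0 <= r <= t ->
    is_derive r 1 (fun r => V1 r - U1 r) (W r - X r).
  by move=> _; exact: (is_derive_sub (V1d r) (U1d r)).
have bnd (r : R) : 0 < r < t -> `|W r - X r| <= K / 2 * (M * expR (M * r)).
  by move=> /andP[r0 rt]; apply: WX; rewrite ltW//= (le_trans (ltW rt)).
have := derive_norm_le t0 VUd Ed bnd; rewrite V10 U10 subrr subr0.
move=> /le_trans; apply; rewrite gerBl mulr_ge0 ?expR_ge0//; lra.
Qed.

Let limit_of_geometric (v : nat -> R) D : 0 <= D ->
  (forall n, `|v n.+1 - v n| <= D * 2^-1 ^+ n) ->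
  exists l, forall n, `|v n - l| <= 2 * D * 2^-1 ^+ n.
Proof.
move=> D0 vD.
have vk n k : `|v (n + k)%N - v n| <= 2 * D * 2^-1 ^+ n - 2 * D * 2^-1 ^+ (n + k).
  elim: k => [|k IH]; first by rewrite addn0 !subrr normr0.
  have := ler_normD (v (n + k).+1 - v (n + k)%N) (v (n + k)%N - v n).
  rewrite addnS addrA subrK => /le_trans; apply.
  have := vD (n + k)%N; rewrite exprS; lra.
have h0 n : 0 <= (2^-1 : R) ^+ n by rewrite exprn_ge0// invr_ge0.
have : cvgn v.
  apply/cauchy_cvgP/cauchy_exP => e e0 /=.
  have : (fun n => 2 * D * 2^-1 ^+ n) @ \oo --> (2 * D * 0 : R).
    by apply: cvgM; [exact: cvg_cst|apply: cvg_expr; rewrite ger0_norm ?invr_ge0//; lra].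
  rewrite mulr0 => /cvgrPdist_lt/(_ e e0)[N _ NP].
  exists (v N); exists N => // n /= Nn.
  rewrite -ball_normE/= distrC.
  have := NP N (leqnn _); rewrite sub0r normrN ger0_norm ?mulr_ge0// => h.
  apply: le_lt_trans h; rewrite -(subnKC Nn); apply: le_trans (vk _ _) _.
  by rewrite gerBl !mulr_ge0.
move=> /cvg_ex[l vl]; exists l => n; rewrite distrC.
have nl : (fun m => `|v m - v n|) @ \oo --> `|l - v n|.
  by apply: cvg_norm; apply: cvgB => //; exact: cvg_cst.
have -> : `|l - v n| = limn (fun m => `|v m - v n|) by apply/esym/cvg_lim.
apply: limr_le; first by apply/cvg_ex; exists `|l - v n|.
exists n => // m /= nm; rewrite -(subnKC nm); apply: le_trans (vk _ _) _.
by rewrite gerBl !mulr_ge0.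
Qed.

Let cvgn_eq (u : nat -> R) (a b : R) : u @ \oo --> a -> u @ \oo --> b -> a = b.
Proof. by move=> /cvg_lim <-// /cvg_lim <-. Qed.

(** The second order equation [V'' = c V' - F (V)] with [F] globally Lipschitz,
    solved for all positive times from a solution given for [t <= 0].  The
    iterates converge uniformly on every half-line [t <= A], at a geometric
    rate. *)
Theorem picard_forward : exists V W : R -> R, [/\
  forall t, is_derive t 1 V (W t),
  forall t, is_derive t 1 W (c * W t - F (V t)),
  forall t, t <= 0 -> V t = V0 t & forall t, t <= 0 -> W t = W0 t].
Proof.
have [T TP] := choice picard_stepP.
pose v n := iter n T V0.
have h0 n : 0 <= (2^-1 : R) ^+ n by rewrite exprn_ge0// invr_ge0.
have V0c : continuous V0 by move=> t; exact: (is_derive_continuous (V0d t)).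
have vc n : continuous (v n).
  by elim: n => // n IH; apply: (@step_cont (v n)); exact: TP.
have vS n : picard_step (v n) (v n.+1) by exact: TP.
have vpast n t : t <= 0 -> v n t = V0 t.
  by elim: n t => // n IH; exact: step_past.
have geo A : 0 <= A -> exists2 D, 0 <= D &
    forall n t, t <= A -> `|v n.+1 t - v n t| <= D * 2^-1 ^+ n.
  move=> A0.
  have [C C0 CP] : exists2 C, 0 <= C & forall t, 0 <= t <= A -> `|v 1 t - v 0 t| <= C.
    have [|m _ mP] := @EVT_max _ (fun t => `|v 1 t - v 0 t|) _ _ A0.
      by apply: continuous_subspaceT => t; apply: cvg_norm; apply: cvgB; exact: vc.
    exists (`|v 1 m - v 0 m|) => // t tA; exact: mP.
  have dv n : forall t, 0 <= t <= A ->
      `|v n.+1 t - v n t| <= C * 2^-1 ^+ n * expR (M * t).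
    elim: n => [|n IH] t t0A.
      rewrite expr0 mulr1; apply: le_trans (CP t t0A) _.
      rewrite ler_peMr// -expR0 ler_expR mulr_ge0//; last by case/andP: t0A.
      exact: le_trans ler01 M1.
    rewrite exprS mulrCA [2^-1 * _]mulrC.
    apply: step_contract IH _ t0A => //.
    by rewrite mulr_ge0// h0.
  exists (C * expR (M * A)) => [|n t tA]; first by rewrite mulr_ge0 ?expR_ge0.
  have [t0|t0] := leP t 0.
    by rewrite !vpast// subrr normr0 !mulr_ge0 ?expR_ge0 ?h0.
  apply: le_trans (dv n t _) _; first by rewrite ltW.
  rewrite mulrAC ler_wpM2r ?h0// ler_wpM2l//.
  by rewrite ler_expR ler_wpM2l// (le_trans ler01 M1).
have /choice[V VP] : forall t, exists l, exists2 D, 0 <= D &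
    forall n, `|v n t - l| <= 2 * D * 2^-1 ^+ n.
  move=> t; have [D D0 DP] := geo `|t| (normr_ge0 _).
  have [n|l lP] := @limit_of_geometric (v ^~ t) D D0.
    by apply: DP; exact: ler_norm.
  by exists l, D.
have half0 : (fun n => 2^-1 ^+ n) @ \oo --> (0 : R).
  by apply: cvg_expr; rewrite ger0_norm ?invr_ge0//; lra.
have vV t : v ^~ t @ \oo --> V t.
  have [D D0 DP] := VP t.
  apply/cvgrPdist_le => e e0.
  have : (fun n => 2 * D * 2^-1 ^+ n) @ \oo --> (2 * D * 0 : R).
    by apply: cvgM; [exact: cvg_cst|exact: half0].
  rewrite mulr0 => /cvgrPdist_le/(_ e e0); apply: filterS => n.
  rewrite sub0r normrN distrC => h; apply: le_trans (DP n) (le_trans (ler_norm _) h).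
have unif A : 0 <= A -> exists2 D, 0 <= D &
    forall n t, t <= A -> `|v n t - V t| <= D * 2^-1 ^+ n.
  move=> A0; have [D D0 DP] := geo A A0; exists (2 * D); first by rewrite mulr_ge0.
  move=> n t tA; have [n'|l lP] := @limit_of_geometric (v ^~ t) D D0.
    exact: DP.
  suff -> : V t = l by exact: lP.
  apply: (@cvgn_eq (v ^~ t)); first exact: vV.
  apply/cvgrPdist_le => e e0.
  have : (fun n => 2 * D * 2^-1 ^+ n) @ \oo --> (2 * D * 0 : R).
    by apply: cvgM; [exact: cvg_cst|exact: half0].
  rewrite mulr0 => /cvgrPdist_le/(_ e e0); apply: filterS => k.
  rewrite sub0r normrN distrC => h; apply: le_trans (lP k) (le_trans (ler_norm _) h).
have small A e : 0 <= A -> 0 < e -> exists n, forall t, t <= A -> `|v n t - V t| <= e.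
  move=> A0 e0; have [D D0 DP] := unif A A0.
  have : (fun n => D * 2^-1 ^+ n) @ \oo --> (D * 0 : R).
    by apply: cvgM; [exact: cvg_cst|exact: half0].
  rewrite mulr0 => /cvgrPdist_le/(_ e e0)[n _ /(_ n (leqnn _))].
  rewrite sub0r normrN => h; exists n => t tA.
  exact: le_trans (DP n t tA) (le_trans (ler_norm _) h).
have Vc : continuous V.
  move=> t; apply/cvgrPdist_le => e e0.
  have [n nP] := small (`|t| + 1) (e / 3) (addr_ge0 (normr_ge0 _) ler01)
    (divr_gt0 e0 (ltr0n _ 3)).
  near=> s.
  have st : `|v n t - v n s| <= e / 3.
    by near: s; apply: cvgr_dist_le; [exact: vc|rewrite divr_gt0].
  have tA : t <= `|t| + 1 by have := ler_norm t; lra.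
  have sA : s <= `|t| + 1.
    suff : `|t - s| <= 1 by have := ler_norm t; rewrite ler_norml; lra.
    by near: s; apply: cvgr_dist_le; [exact: cvg_id|].
  have := nP t tA; have := nP s sA; move: st.
  by rewrite !ler_norml => /andP[? ?] /andP[? ?] /andP[? ?]; apply/andP; split; lra.
have VS : picard_step V (T V) by exact: TP.
have Vpast t : t <= 0 -> V t = V0 t.
  move=> t0; apply: (@cvgn_eq (v ^~ t)); first exact: vV.
  under eq_fun do rewrite vpast//; exact: cvg_cst.
have TV : T V = V.
  apply/funext => t; have [t0|t0] := leP t 0.
    by rewrite (step_past VS Vpast t0) Vpast.
  apply: (@cvgn_eq (v ^~ t)); last exact: vV.
  have [D D0 DP] := unif t (ltW t0).
  rewrite -(cvg_shiftS (v ^~ t)); apply/cvgrPdist_le => e e0.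
  have : (fun n => D * 2^-1 ^+ n * (2^-1 * expR (M * t))) @ \oo -->
      (D * 0 * (2^-1 * expR (M * t)) : R).
    apply: cvgM; last exact: cvg_cst.
    by apply: cvgM; [exact: cvg_cst|exact: half0].
  rewrite mulr0 mul0r => /cvgrPdist_le/(_ e e0); apply: filterS => n.
  rewrite sub0r normrN => /(le_trans (ler_norm _)); apply: le_trans.
  rewrite mulrA distrC.
  apply: (@step_contract _ _ _ _ t _ _ (vS n) VS) => //; last first.
  - by rewrite (ltW t0) lexx.
  - move=> s /andP[s0 st]; apply: le_trans (DP n s st) _.
    rewrite ler_peMr ?mulr_ge0 ?h0//.
    by rewrite -expR0 ler_expR mulr_ge0// (le_trans ler01 M1).
  - by rewrite mulr_ge0 ?h0.
have [W [_ W10 Vd Wd]] := VS; rewrite TV in Vd.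
by exists V, W; split => //; exact: step_past_deriv W10 Wd Vpast.
Unshelve. all: by end_near. Qed.

End Picard.

(** * Concave reactions *)

Section Monostable.
Context {R : realType}.
Variables (f : R -> R).
Hypothesis fmono : monostable f.
Implicit Types a b s x y : R.

Lemma monostable_derive x : is_derive x 1 f (f^`() x).
Proof.
by case: fmono => -[fd _ _] _ _ _; rewrite derive1E; exact/derivableP/fd.
Qed.

Let fd2 x : is_derive x 1 f^`() (f^`(2) x).
Proof.
by case: fmono => -[_ fd _] _ _ _; rewrite /= derive1E; exact/derivableP/fd.
Qed.

Let f0 : f 0 = 0. Proof. by case: fmono. Qed.
Let f1 : f 1 = 0. Proof. by case: fmono. Qed.

Let df_decr a b : 0 <= a -> a < b -> b <= 1 -> f^`() b < f^`() a.
Proof.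
move=> a0 ab b1; have [x /andP[ax xb] fE] := MVT_closed ab (fun x _ => fd2 x).
have : f^`(2) x < 0.
  by case: fmono => _ _ _; apply; rewrite (le_trans a0 (ltW ax)) (le_trans (ltW xb)).
by move=> fx; rewrite -subr_lt0 fE nmulr_rlt0// subr_gt0.
Qed.

(** Comparison of the slopes of two adjacent chords, with the denominators
    cleared. *)
Lemma monostable_chord a s b : 0 <= a -> a < s -> s < b -> b <= 1 ->
  (f b - f s) * (s - a) < (f s - f a) * (b - s).
Proof.
move=> a0 as_ sb b1.
have [x /andP[ax xs] ->] := MVT_closed as_ (fun x _ => monostable_derive x).
have [y /andP[sy yb] ->] := MVT_closed sb (fun x _ => monostable_derive x).
rewrite mulrAC -!mulrA ltr_pM2r ?mulr_gt0 ?subr_gt0//.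
by apply: df_decr; lra.
Qed.

Lemma monostable_gt0 s : 0 < s < 1 -> 0 < f s.
Proof.
move=> /andP[s0 s1]; have := monostable_chord (lexx 0) s0 s1 (lexx 1).
rewrite f0 f1; nra.
Qed.

Lemma monostable_ge0 s : 0 <= s <= 1 -> 0 <= f s.
Proof.
move=> /andP[]; rewrite le_eqVlt => /predU1P[<- _|s0]; first by rewrite f0.
rewrite le_eqVlt => /predU1P[->|s1]; first by rewrite f1.
by rewrite ltW// monostable_gt0// s0.
Qed.

Lemma monostable_chord1 a s : 0 <= a -> a <= s -> s <= 1 ->
  f a * (1 - s) <= f s * (1 - a).
Proof.
move=> a0; rewrite le_eqVlt => /predU1P[->//|as_].
rewrite le_eqVlt => /predU1P[->|s1]; first by rewrite f1 subrr mulr0 mul0r.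
have := monostable_chord a0 as_ s1 (lexx 1); rewrite f1; nra.
Qed.

(** The derivative decreases on [[0, 1]], so its values at the end points bound
    it. *)
Lemma monostable_lipschitz : exists2 L, 0 <= L &
  forall x y, 0 <= x <= 1 -> 0 <= y <= 1 -> `|f x - f y| <= L * `|x - y|.
Proof.
exists (`|f^`() 0| + `|f^`() 1|); first by rewrite addr_ge0.
move=> x y; wlog xy : x y / x < y => [hw x01 y01|].
  have [xy|yx|->] := ltgtP x y; first exact: hw.
    by rewrite distrC [`|x - y|]distrC; exact: hw.
  by rewrite !subrr normr0 mulr0.
move=> /andP[x0 x1] /andP[y0 y1].
have [z /andP[xz zy]] := MVT_closed xy (fun x _ => monostable_derive x).
rewrite distrC [`|x - y|]distrC => ->; rewrite normrM ler_wpM2r//.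
have z0 : 0 < z by rewrite (le_lt_trans x0).
have z1 : z < 1 by rewrite (lt_le_trans zy).
have := df_decr (lexx 0) z0 (ltW z1); have := df_decr (ltW z0) z1 (lexx 1).
have := ler_norm (f^`() 0); have := lerNnormlW (lexx (`|f^`() 1|)).
have := normr_ge0 (f^`() 0); have := normr_ge0 (f^`() 1).
by rewrite ler_norml => *; apply/andP; split; lra.
Qed.

End Monostable.

(** * The front of the reaction cut by a chord *)

Section Front.
Context {R : realType}.
Variables (f : R -> R) (s1 : R).
Hypothesis fmono : monostable f.
Hypothesis s01 : 0 < s1 < 1.
Implicit Types s x y t : R.

Let s1_gt0 : 0 < s1. Proof. by case/andP: s01. Qed.
Let s1_lt1 : s1 < 1. Proof. by case/andP: s01. Qed.
Let f0 : f 0 = 0. Proof. by case: fmono. Qed.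

Definition chord_slope := f s1 / (1 - s1).

(** The reaction [f] up to [s1], and above it the chord that joins [(s1, f s1)] to
    [(1, 0)].  The truncations extend it by constants outside [[0, 1]], which
    makes it Lipschitz on the whole line. *)
Definition chord_cut s := f (clip 0 s1 s) - chord_slope * (clip s1 1 s - s1).

Lemma chord_slope_gt0 : 0 < chord_slope.
Proof. by rewrite divr_gt0 ?subr_gt0// monostable_gt0. Qed.

Lemma chord_cut_lipschitz :
  exists L, forall x y, `|chord_cut x - chord_cut y| <= L * `|x - y|.
Proof.
have [L L0 fL] := monostable_lipschitz fmono.
exists (L + chord_slope) => x y.
have -> : chord_cut x - chord_cut y = (f (clip 0 s1 x) - f (clip 0 s1 y))
    - chord_slope * (clip s1 1 x - clip s1 1 y) by rewrite /chord_cut; ring.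
apply: le_trans (ler_normB _ _) _; rewrite mulrDl lerD//.
  have cb z : 0 <= clip 0 s1 z <= 1.
    by have /andP[-> h] := clip_bounds z (ltW s1_gt0); rewrite (le_trans h)// ltW.
  apply: le_trans (fL _ _ (cb x) (cb y)) _.
  by rewrite ler_wpM2l// clip_nonexpansive.
rewrite normrM gtr0_norm ?chord_slope_gt0//.
by rewrite ler_wpM2l ?clip_nonexpansive// ltW// chord_slope_gt0.
Qed.

Lemma chord_cut_continuous : continuous chord_cut.
Proof.
by have [L] := chord_cut_lipschitz; exact: lipschitz_continuous.
Qed.

Lemma chord_cut_lower s : 0 <= s <= s1 -> chord_cut s = f s.
Proof.
move=> /[dup] ss /andP[s0 ss1]; rewrite /chord_cut clip_id//.
by rewrite (clip_le (ltW s1_lt1))// subrr mulr0 subr0.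
Qed.

Lemma chord_cut_upper s : s1 <= s <= 1 -> chord_cut s = chord_slope * (1 - s).
Proof.
move=> /[dup] ss /andP[s0 ss1]; rewrite /chord_cut (clip_ge (ltW s1_gt0))//.
rewrite clip_id// /chord_slope.
have : 1 - s1 != 0 by rewrite subr_eq0 gt_eqF.
by move=> ?; field.
Qed.

Lemma chord_cut_neg s : s <= 0 -> chord_cut s = 0.
Proof.
move=> s0; rewrite /chord_cut (clip_le (ltW s1_gt0))// f0.
by rewrite (clip_le (ltW s1_lt1)) ?(le_trans s0)// ?ltW// subrr mulr0 subr0.
Qed.

Lemma chord_cut_ge0 s : 0 <= chord_cut s.
Proof.
have [s0|s0] := leP s 0; first by rewrite chord_cut_neg.
have [ss|ss] := leP s s1.
  by rewrite chord_cut_lower ?monostable_ge0// ?ss ltW//= (le_trans ss)// ltW.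
have [s1'|s1'] := leP s 1.
  rewrite chord_cut_upper; last by rewrite s1' ltW.
  by rewrite mulr_ge0 ?subr_ge0// ltW// chord_slope_gt0.
rewrite /chord_cut (clip_ge (ltW s1_gt0) (ltW ss)).
by rewrite (clip_ge (ltW s1_lt1) (ltW s1')) divfK ?subrr// subr_eq0 gt_eqF.
Qed.

(** A concave function lies above its chords. *)
Lemma chord_cut_le s : 0 <= s <= 1 -> chord_cut s <= f s.
Proof.
move=> /andP[s0 ss]; have [s1s|s1s] := leP s s1; first by rewrite chord_cut_lower ?s0.
rewrite chord_cut_upper ?ss ?andbT; last exact: ltW.
rewrite /chord_slope mulrAC ler_pdivrMr ?subr_gt0//.
by apply: monostable_chord1 => //; exact: ltW.
Qed.

Variables (c lam : R).
Hypothesis lam_gt0 : 0 < lam.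
Hypothesis lamE : lam ^+ 2 - c * lam = chord_slope.

(** The front in the variable [t = - x], with its derivative [W].  Its part above
    [s1] sits on [t <= 0], where the reaction is affine in [V] and the solution an
    explicit exponential. *)
Definition reversed_front (V W : R -> R) := [/\
  forall t, is_derive t 1 V (W t),
  forall t, is_derive t 1 W (c * W t - chord_cut (V t)),
  forall t, t <= 0 -> V t = 1 - (1 - s1) * expR (lam * t),
  W 0 = - ((1 - s1) * lam) & forall t, W t < 0].

(** The equation of [lam] says that the exponential solves the affine equation, so
    it is an admissible past for the Picard theorem.  As the reaction is
    nonnegative, [- exp (- c t) W] does not decrease, which keeps [W] negative. *)
Lemma reversed_front_exists : exists V W, reversed_front V W.
Proof.
have [L FL] := chord_cut_lipschitz.
pose V0 (t : R) := 1 - (1 - s1) * expR (lam * t).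
pose W0 (t : R) := - ((1 - s1) * lam) * expR (lam * t).
have V0d t : is_derive t 1 V0 (W0 t).
  apply: is_derive_replace (is_derive_sub (is_derive_cst _ _ _)
    (is_derive_mull (1 - s1) (is_derive_expRM lam t))) _.
  by rewrite /W0; ring.
have W0d t : t <= 0 -> is_derive t 1 W0 (c * W0 t - chord_cut (V0 t)).
  move=> t0.
  apply: is_derive_replace
    (is_derive_mull (- ((1 - s1) * lam)) (is_derive_expRM lam t)) _.
  have e1 : expR (lam * t) <= 1 by rewrite -expR0 ler_expR pmulr_rle0.
  have e0 := expR_gt0 (lam * t).
  rewrite chord_cut_upper /V0 /W0; last first.
    apply/andP; split; last by rewrite gerBl mulr_ge0 ?subr_ge0 ?ltW.
    have := s1_lt1; nra.
  rewrite -lamE; ring.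
have [V [W [Vd Wd Vp Wp]]] := picard_forward FL V0d W0d.
exists V, W; split => //.
  by rewrite Wp// /W0 mulr0 expR0 mulr1.
move=> t; have [t0|t0] := leP t 0.
  by rewrite Wp// /W0 nmulr_rlt0 ?expR_gt0// oppr_lt0 mulr_gt0// subr_gt0.
have Zd (s : R) : 0 <= s <= t -> is_derive s 1 (fun s => - (expR (- c * s) * W s))
    (expR (- c * s) * chord_cut (V s)).
  move=> _; apply: is_derive_replace (is_deriveN
    (is_derive_mul (is_derive_expRM (- c) s) (Wd s))) _; ring.
have := derive_ge0_le (ltW t0) Zd.
move=> /(_ (fun s _ => mulr_ge0 (expR_ge0 _) (chord_cut_ge0 _))).
rewrite mulr0 expR0 mul1r Wp// /W0 mulr0 expR0 mulr1 opprK => h.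
have : 0 < - (expR (- c * t) * W t).
  by apply: lt_le_trans h; rewrite mulr_gt0// subr_gt0.
by rewrite oppr_gt0 pmulr_rlt0// expR_gt0.
Qed.

Section Properties.
Variables V W : R -> R.
Hypothesis VW : reversed_front V W.

Lemma reversed_front_decr x y : x < y -> V y < V x.
Proof.
case: VW => Vd _ _ _ W_lt0 xy.
have := derive_gt0_lt xy (fun t _ => is_deriveN (Vd t)).
rewrite ltrN2; apply => t _; by rewrite oppr_gt0.
Qed.

Lemma reversed_front_nincr x y : x <= y -> V y <= V x.
Proof.
rewrite le_eqVlt => /predU1P[->//|xy]; exact/ltW/reversed_front_decr.
Qed.

Lemma reversed_front0 : V 0 = s1.
Proof. by case: VW => _ _ -> // _ _; rewrite mulr0 expR0; ring. Qed.

Lemma reversed_front_le1 t : V t <= 1.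
Proof.
have [t0|t0] := leP t 0.
  case: VW => _ _ -> // _ _; rewrite gerBl mulr_ge0 ?expR_ge0//.
  by rewrite subr_ge0 ltW.
apply: le_trans (reversed_front_nincr (ltW t0)) _.
by rewrite reversed_front0 ltW.
Qed.

Lemma reversed_front_continuous : continuous V.
Proof. by case: VW => Vd _ _ _ _ t; exact: is_derive_continuous (Vd t). Qed.

Lemma reversed_front_dichotomy : (exists2 T, 0 < T & V T = 0) \/ forall t, 0 < V t.
Proof.
have [[T VT]|nT] := pselect (exists t, V t <= 0); last first.
  by right => t; rewrite ltNge; apply/negP => Vt; apply: nT; exists t.
left.
have T0 : 0 <= T.
  rewrite leNgt; apply/negP => T0; have := reversed_front_decr T0.
  by rewrite reversed_front0; have := s1_gt0; lra.
have [] := @IVT _ V 0 T 0 T0 (continuous_subspaceT _).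
- exact: reversed_front_continuous.
- rewrite reversed_front0 /Num.min /Num.max; have := s1_gt0.
  by do 2 case: ltP => ?; lra.
move=> t; rewrite in_itv/= => /andP[t0 _] Vt; exists t => //.
rewrite lt_neqAle t0 andbT; apply/eqP => t0'.
have : V t = s1 by rewrite -t0' reversed_front0.
by rewrite Vt => s10; have := s1_gt0; rewrite -s10 ltxx.
Qed.

(** A front bounded away from [0] would feel a reaction bounded below, which
    forces its slope to [-oo]. *)
Lemma reversed_front_vanish : (forall t, 0 < V t) ->
  forall e, 0 < e -> exists2 t, 0 <= t & V t < e.
Proof.
move=> V0 e e0; apply: contrapT => h.
have {}h t : 0 <= t -> e <= V t.
  by move=> t0; rewrite leNgt; apply/negP => Vt; apply: h; exists t.
have Vs1 t : 0 <= t -> V t <= s1 by move=> t0; rewrite -reversed_front0 reversed_front_nincr.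
have es1 : e <= s1 by rewrite -reversed_front0 h.
have fc : {within `[e, s1], continuous f}.
  apply: continuous_subspaceT => x; exact: is_derive_continuous (monostable_derive fmono x).
have [m] := EVT_min es1 fc; rewrite in_itv/= => /andP[em ms1] mP.
have eta0 : 0 < f m by apply: monostable_gt0; rewrite // (lt_le_trans e0)//= (le_lt_trans ms1).
set eta := f m in mP eta0.
case: VW => Vd Wd _ W0E W_lt0.
have fV t : 0 <= t -> eta <= chord_cut (V t).
  move=> t0; rewrite chord_cut_lower; last by rewrite ltW//= Vs1.
  by apply: mP; rewrite in_itv/= h// Vs1.
have WB t : 0 <= t -> W t <= 2 * `|c| - eta * t.
  move=> t0.
  have gd (r : R) : 0 <= r <= t ->
      is_derive r 1 (fun r => c * V r - W r - eta * r) (chord_cut (V r) - eta).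
    move=> _; apply: is_derive_replace (is_derive_sub (is_derive_sub
      (is_derive_mull c (Vd r)) (Wd r)) (is_derive_mull eta (is_derive_id r 1))) _.
    ring.
  have := derive_ge0_le t0 gd.
  have g0 (r : R) : 0 < r < t -> 0 <= chord_cut (V r) - eta.
    by move=> /andP[r0 _]; rewrite subr_ge0 fV// ltW.
  move=> /(_ g0); rewrite mulr0 subr0.
  have cV r : 0 <= r -> `|c * V r| <= `|c|.
    move=> r0; rewrite normrM ler_piMr// ger0_norm ?(ltW (V0 _))//.
    exact: reversed_front_le1.
  have := cV 0 (lexx 0); have := cV t t0; rewrite !ler_norml => /andP[_ ?] /andP[? _].
  by have := W_lt0 0; lra.
pose t := 1 + (4 * `|c| + 4) / eta.
have q0 : 0 <= (4 * `|c| + 4) / eta by rewrite divr_ge0 ?addr_ge0 ?mulr_ge0// ltW.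
have t0 : 0 <= t by rewrite /t; lra.
have hd (r : R) : 0 <= r <= t ->
    is_derive r 1 (fun r => 2 * `|c| * r - eta / 2 * r ^+ 2 - V r)
      (2 * `|c| - eta * r - W r).
  move=> _; apply: is_derive_replace (is_derive_sub (is_derive_sub
    (is_derive_mull (2 * `|c|) (is_derive_id r 1))
    (is_derive_mull (eta / 2) (is_derive_mul (is_derive_id r 1) (is_derive_id r 1)))) (Vd r)) _.
  by field.
have h0 (r : R) : 0 < r < t -> 0 <= 2 * `|c| - eta * r - W r.
  by move=> /andP[r0 _]; rewrite subr_ge0 WB// ltW.
have := derive_ge0_le t0 hd h0; rewrite expr0n/= !mulr0 subr0 sub0r reversed_front0.
have := V0 t.
have et : eta * t = eta + (4 * `|c| + 4).
  by rewrite /t mulrDr mulr1 mulrC divfK// gt_eqF.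
have : eta / 2 * t ^+ 2 = (eta * t) * t / 2 by rewrite expr2; field.
rewrite et => ->.
have := s1_lt1; have t1 : 1 <= t by rewrite /t; lra.
have := normr_ge0 c; nra.
Qed.

End Properties.
End Front.

(** * Finite measures with a density and a point mass *)

Section Measures.
Context {R : realType}.
Notation leb := (@lebesgue_measure R).

(** Integration against the measure with density [g] is reduced to [g] through the
    Radon-Nikodym derivative, which is almost everywhere equal to [g]. *)
Lemma density_measure (g : R -> R) :
  (forall x, 0 <= g x) -> leb.-integrable setT (EFin \o g) ->
  exists nu : {finite_measure set (measurableTypeR R) -> \bar R},
    nu setT = (\int[leb]_x (g x)%:E)%E /\
    forall h : R -> R, nu.-integrable setT (EFin \o h) ->
      (\int[nu]_x (h x)%:E = \int[leb]_x (h x * g x)%:E)%E.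
Proof.
move=> g0 ig.
have mg := measurable_int leb ig.
pose nu0 (A : set (measurableTypeR R)) := (\int[leb]_(x in A) (g x)%:E)%E.
have nu00 : nu0 set0 = 0%E by rewrite /nu0 integral_set0.
have nu0_ge0 A : (0 <= nu0 A)%E by apply: integral_ge0 => x _; rewrite lee_fin.
have nu0_sa : semi_sigma_additive nu0.
  move=> /= F mF tF mUF; rewrite /nu0; apply: cvg_toP.
    apply: ereal_nondecreasing_is_cvgn => m n mn.
    by apply: lee_sum_nneg_natr => // k _ _; exact: nu0_ge0.
  rewrite ge0_integral_bigcup//=.
  - exact: (measurable_funS measurableT (@subsetT _ _) mg).
  - by move=> x _; rewrite lee_fin.
pose mixM := isMeasure.Build _ _ _ nu0 nu00 nu0_ge0 nu0_sa.
pose nuM : {measure set (measurableTypeR R) -> \bar R} := HB.pack nu0 mixM.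
have nu_fin : fin_num_fun nuM.
  move=> A mA; rewrite ge0_fin_numE; last exact: nu0_ge0.
  apply: (@le_lt_trans _ _ (nu0 setT)).
    by apply: ge0_subset_integral => //; move=> x _; rewrite lee_fin.
  exact: integral_fune_lt_pinfty.
pose mixF := Measure_isFinite.Build _ _ _ nuM nu_fin.
pose nu : {finite_measure set (measurableTypeR R) -> \bar R} := HB.pack nu0 nuM mixF.
exists nu; split => // h ih.
have dom : nu `<< leb.
  apply/null_content_dominatesP => A mA A0.
  rewrite /nu /= /nu0; apply: null_set_integral => //.
  exact: (measurable_funS measurableT (@subsetT _ _) mg).
rewrite -(Radon_Nikodym_change_of_variables dom)//=.
apply: ae_eq_integral => //.
- apply: emeasurable_funM => //; first exact: (measurable_int nu).
- have mh := measurable_int nu ih; under eq_fun do rewrite EFinM.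
  by apply: emeasurable_funM.
- under [X in ae_eq _ _ _ X]eq_fun do rewrite EFinM.
  apply: ae_eqe_mul2l => /=.
  apply: integral_ae_eq => //.
  + by apply: Radon_Nikodym_integrable; exact: dom.
  + move=> E _ mE.
    by have <- := @Radon_Nikodym_integral _ _ _ (charge_of_finite_measure nu) leb E dom mE.
Qed.

Lemma bounded_integrable (nu : {finite_measure set (measurableTypeR R) -> \bar R})
    (h : R -> R) (M : R) : continuous h -> (forall x, `|h x| <= M) ->
  nu.-integrable setT (EFin \o h).
Proof.
move=> hc hM; apply: (@le_integrable _ _ _ _ _ _ _ (EFin \o cst M)) => //.
- by apply/measurable_EFinP; exact: continuous_measurable_fun.
- move=> x _ /=; rewrite lee_fin (le_trans (hM x))// ler_norm//.
- exact: finite_measure_integrable_cst.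
Qed.

(** The kind of source that a front produces: a point mass where it is cut, and a
    density elsewhere. *)
Lemma point_mass_density (g : R -> R) (p a : R) :
  0 <= p -> (forall x, 0 <= g x) -> leb.-integrable setT (EFin \o g) ->
  exists mu : {finite_measure set (measurableTypeR R) -> \bar R},
    mu setT = (p%:E + \int[leb]_x (g x)%:E)%E /\
    forall (h : R -> R) (M : R), continuous h -> (forall x, `|h x| <= M) ->
      (\int[mu]_x (h x)%:E = (p * h a)%:E + \int[leb]_x (h x * g x)%:E)%E.
Proof.
move=> p0 g0 ig; have [nu [nuT nuE]] := density_measure g0 ig.
pose m1 : {measure set (measurableTypeR R) -> \bar R} :=
  mscale (NngNum p0) (dirac (a : measurableTypeR R)).
pose mM : {measure set (measurableTypeR R) -> \bar R} := measure_add m1 nu.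
have m1T : m1 setT = p%:E by rewrite /m1 /= /mscale/= diracT mule1.
have m1_fin : fin_num_fun m1.
  by move=> A mA; rewrite /m1 /= /mscale/= fin_numM// fin_num_measure.
have m_fin : fin_num_fun mM.
  move=> A mA; have -> : mM A = (m1 A + nu A)%E := measure_addE m1 nu A.
  by rewrite fin_numD m1_fin// fin_num_measure.
pose mixF := Measure_isFinite.Build _ _ _ mM m_fin.
pose mu : {finite_measure set (measurableTypeR R) -> \bar R} :=
  HB.pack (Measure.sort mM) mM mixF.
pose mixF1 := Measure_isFinite.Build _ _ _ m1 m1_fin.
pose m1F : {finite_measure set (measurableTypeR R) -> \bar R} :=
  HB.pack (Measure.sort m1) m1 mixF1.
exists mu; split.
  by have -> : mu setT = (m1 setT + nu setT)%E := measure_addE m1 nu setT; rewrite m1T nuT.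
move=> h M hc hM.
have ih (n : {finite_measure set (measurableTypeR R) -> \bar R}) :=
  bounded_integrable n hc hM.
have mh := measurable_int _ (ih nu).
have -> : (\int[mu]_x (h x)%:E = \int[measure_add m1 nu]_x (h x)%:E)%E by [].
rewrite integral_measure_add//; [|exact: (ih m1F)|exact: ih].
rewrite nuE//; congr (_ + _)%E.
rewrite integralE ge0_integral_mscale//; last exact: measurable_funepos.
rewrite ge0_integral_mscale//; last exact: measurable_funeneg.
rewrite !integral_dirac//; [|exact: measurable_funeneg|exact: measurable_funepos].
rewrite !diracT !mul1e /= -muleBr//.
- rewrite EFinM; congr (_ * _)%E.
  exact: (esym (congr1 (fun k => k a) (funeposneg (EFin \o h)))).
- exact: add_def_funeposneg.
Qed.

End Measures.

(** * One-dimensional cost of the front *)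

Section TestFunctions.
Context {R : realType}.
Variable phi : R -> R.
Hypothesis phi_smooth : smooth phi.

Lemma smooth_derive (n : nat) (x : R) : is_derive x 1 phi^`(n) (phi^`(n.+1) x).
Proof. by rewrite /= derive1E; exact/derivableP/phi_smooth. Qed.

Lemma smooth_continuous n : continuous phi^`(n).
Proof. by move=> x; exact: is_derive_continuous (smooth_derive n x). Qed.

Lemma smooth_vanish (A : R) : (forall x, A < `|x| -> phi x = 0) ->
  forall (n : nat) (x : R), A < `|x| -> phi^`(n) x = 0.
Proof.
move=> phiA; elim=> [//|n IH] x Ax.
have h : is_derive x 1 phi^`(n) 0.
  apply: (near_eq_is_derive _ (is_derive_cst 0 x 1)).
  near=> y; rewrite IH//.
  by near: y; apply: (cvgr_gt `|x|) => //; apply: cvg_norm; exact: cvg_id.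
have := smooth_derive n x => h'.
by rewrite -(@derive_val _ _ _ _ _ _ _ h') (@derive_val _ _ _ _ _ _ _ h).
Unshelve. all: by end_near. Qed.

End TestFunctions.

Section UpperBound.
Context {R : realType}.
Notation leb := (@lebesgue_measure R).

Lemma integral_vanish_off (D : set R) (h : R -> R) : measurable D ->
  (forall x, ~ D x -> h x = 0) ->
  (\int[leb]_x (h x)%:E = \int[leb]_(x in D) (h x)%:E)%E.
Proof.
move=> mD h0; rewrite [RHS]integral_mkcond; apply: eq_integral => x _.
rewrite patchE; case: ifPn => // /negP Dx; rewrite h0// => xD.
by apply: Dx; rewrite inE.
Qed.

Variables (f : R -> R) (s1 c lam : R) (V W : R -> R).
Hypothesis fmono : monostable f.
Hypothesis s01 : 0 < s1 < 1.
Hypothesis lam_gt0 : 0 < lam.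
Hypothesis VW : reversed_front f s1 c lam V W.

Let f0 : f 0 = 0. Proof. by case: fmono. Qed.
Let f1 : f 1 = 0. Proof. by case: fmono. Qed.
Let s1_gt0 : 0 < s1. Proof. by case/andP: s01. Qed.
Let s1_lt1 : s1 < 1. Proof. by case/andP: s01. Qed.
Let V0 := reversed_front0 VW.
Let Vle1 := reversed_front_le1 s01 VW.
Let Vnincr := reversed_front_nincr VW.
Let Vc := reversed_front_continuous VW.
Let fc : continuous f.
Proof. by move=> x; exact: is_derive_continuous (monostable_derive fmono x). Qed.
Let Fc := chord_cut_continuous fmono s01.

Definition front_profile (x : R) := Num.max (V (- x)) 0.

(** What is left of the equation of [f] when the front of [chord_cut f s1] is
    inserted in it.  The truncation keeps this continuous, and zero, beyond the
    point where [V] changes sign. *)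
Definition front_source (x : R) :=
  f (clip 0 1 (V (- x))) - chord_cut f s1 (V (- x)).

Lemma front_source_continuous : continuous front_source.
Proof.
have vc : continuous (fun x => V (- x)).
  by move=> x; apply: continuous_comp; [exact: oppr_continuous|exact: Vc].
move=> x; apply: cvgB.
  apply: (@continuous_comp _ _ _ (fun x => clip 0 1 (V (- x))) f); last exact: fc.
  by apply: (@continuous_comp _ _ _ (fun x => V (- x)) (clip 0 1)); [exact: vc|exact: clip_continuous].
by apply: (@continuous_comp _ _ _ (fun x => V (- x)) (chord_cut f s1)); [exact: vc|exact: Fc].
Qed.

Lemma front_source_neg x : V (- x) <= 0 -> front_source x = 0.
Proof.
by move=> Vx; rewrite /front_source clip_le// f0 chord_cut_neg// subrr.
Qed.

Lemma front_source_pos x : 0 <= V (- x) ->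
  front_source x = f (V (- x)) - chord_cut f s1 (V (- x)).
Proof. by move=> Vx; rewrite /front_source clip_id// Vx Vle1. Qed.

Lemma front_source_left x : x <= 0 -> front_source x = 0.
Proof.
move=> x0; have [Vx|Vx] := leP (V (- x)) 0; first exact: front_source_neg.
rewrite front_source_pos ?chord_cut_lower ?subrr// ltW//=.
by rewrite -V0 Vnincr// oppr_ge0.
Qed.

Lemma front_source_ge0 x : 0 <= front_source x.
Proof.
have [Vx|Vx] := leP (V (- x)) 0; first by rewrite front_source_neg.
rewrite front_source_pos; last exact: ltW.
by rewrite subr_ge0 chord_cut_le// ltW//= Vle1.
Qed.

(** Above [s1] both [f] and the source are at most [L] times the distance to [1],
    which decays exponentially; an exponential density has a known integral. *)
Lemma front_source_le L x :
  (forall x y, 0 <= x <= 1 -> 0 <= y <= 1 -> `|f x - f y| <= L * `|x - y|) ->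
  front_source x <= L * (1 - s1) / lam * exponential_pdf lam x.
Proof.
move=> fL; have L0 : 0 <= L.
  have := fL 1 0; rewrite !lexx ler01 subr0 normr1 mulr1 => /(_ isT isT).
  exact: le_trans.
have [x0|x0] := leP x 0.
  have lam0 := ltW lam_gt0; have s1' : 0 <= 1 - s1 by rewrite subr_ge0 ltW.
  by rewrite front_source_left// mulr_ge0 ?exponential_pdf_ge0// divr_ge0 ?mulr_ge0.
rewrite exponential_pdfE; last exact: ltW.
have VE : V (- x) = 1 - (1 - s1) * expR (- lam * x).
  by case: VW => _ _ -> //; [rewrite mulrN mulNr|rewrite oppr_le0 ltW].
have Vx : s1 <= V (- x) by rewrite -V0 Vnincr// oppr_le0 ltW.
have Vx0 : 0 <= V (- x) by rewrite (le_trans _ Vx)// ltW.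
rewrite front_source_pos//; apply: (@le_trans _ _ (f (V (- x)))).
  by rewrite gerBl chord_cut_ge0.
have := fL 1 (V (- x)); rewrite lexx ler01 Vx0 Vle1 f1 sub0r normrN => /(_ isT isT).
rewrite ger0_norm; last by rewrite monostable_ge0// Vx0 Vle1.
move=> /le_trans; apply; rewrite ger0_norm ?subr_ge0 ?Vle1// VE.
rewrite [leRHS](_ : _ = L * ((1 - s1) * expR (- lam * x))).
  by rewrite ler_wpM2l//; lra.
by field; rewrite gt_eqF.
Qed.

Lemma front_source_integrable : leb.-integrable setT (EFin \o front_source).
Proof.
have [L L0 fL] := monostable_lipschitz fmono.
have ig := @integrableZl _ _ _ leb setT measurableT (L * (1 - s1) / lam) _
  (integrable_exponential_pdf lam_gt0).
apply: (le_integrable measurableT _ _ ig).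
- apply/measurable_EFinP; apply: continuous_measurable_fun.
  exact: front_source_continuous.
- move=> x _ /=; rewrite lee_fin ger0_norm ?front_source_ge0//.
  exact: le_trans (front_source_le x fL) (ler_norm _).
Qed.

Lemma front_source_mass L :
  (forall x y, 0 <= x <= 1 -> 0 <= y <= 1 -> `|f x - f y| <= L * `|x - y|) ->
  (\int[leb]_x (front_source x)%:E <= (L * (1 - s1) / lam)%:E)%E.
Proof.
move=> fL.
have ie := integrable_exponential_pdf lam_gt0.
have ig := @integrableZl _ _ _ leb setT measurableT (L * (1 - s1) / lam) _ ie.
rewrite -[leRHS]mule1 -(integral_exponential_pdf lam_gt0) -integralZl//.
apply: le_integral => //.
- exact: front_source_integrable.
- by move=> x _; rewrite -EFinM lee_fin front_source_le.
Qed.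

Lemma front_profile_homo : {homo front_profile : x y / x <= y}.
Proof.
move=> x y xy; rewrite /front_profile ge_max !le_max lexx orbT andbT.
by rewrite Vnincr// lerN2.
Qed.

Lemma front_profile_le1 x : front_profile x <= 1.
Proof. by rewrite /front_profile ge_max Vle1 ler01. Qed.

Lemma front_profile_ge0 x : 0 <= front_profile x.
Proof. by rewrite /front_profile le_max lexx orbT. Qed.

Lemma front_profile_cvgy : front_profile x @[x --> +oo] --> (1 : R).
Proof.
apply/cvgrPdist_le => e e0.
near=> x; have x0 : 0 <= x by near: x; exact: nbhs_pinfty_ge.
have xe : e^-1 / lam <= x by near: x; apply: nbhs_pinfty_ge; exact: num_real.
rewrite ger0_norm ?subr_ge0 ?front_profile_le1//.
apply: (@le_trans _ _ (1 - V (- x))); first by rewrite lerD2l lerN2 /front_profile le_max lexx.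
case: VW => _ _ -> //; rewrite ?oppr_le0// => _ _.
rewrite mulrN expRN; have e1 : e^-1 <= expR (lam * x).
  move: xe; rewrite ler_pdivrMr// mulrC => /le_trans; apply.
  by apply: le_trans (expR_ge1Dx _); rewrite lerDr.
have ex : (expR (lam * x))^-1 <= e.
  by rewrite -[leRHS]invrK lef_pV2 ?posrE ?invr_gt0 ?expR_gt0.
have ex0 : 0 < (expR (lam * x))^-1 by rewrite invr_gt0 expR_gt0.
by have := s1_gt0; nra.
Unshelve. all: by end_near. Qed.

Lemma front_profile_cvgNy : (forall e, 0 < e -> exists2 t, 0 <= t & V t < e) ->
  front_profile x @[x --> -oo] --> (0 : R).
Proof.
move=> Vsmall; apply/cvgrPdist_le => e e0; have [t t0 Vt] := Vsmall e e0.
near=> x; rewrite sub0r normrN ger0_norm ?front_profile_ge0//.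
rewrite /front_profile ge_max (ltW e0) andbT (le_trans _ (ltW Vt))// Vnincr//.
rewrite lerNr; near: x; apply: nbhs_ninfty_le; exact: num_real.
Unshelve. all: by end_near. Qed.

(** The distributional equation of the front, as one application of the
    fundamental theorem of calculus to [psi].  The point [a] is either the place
    where the front is cut, or any point to the left of the support of [phi]. *)
Section TestedEquation.
Variables (phi : R -> R) (a B : R).
Hypothesis phi_smooth : smooth phi.
Hypothesis aB : a < B.
Hypothesis phiB : forall (n : nat) x, B <= x -> phi^`(n) x = 0.
Hypothesis Va : 0 <= V (- a).
Hypothesis off_a : forall x, x < a ->
  (V (- x) <= 0) \/ (forall n : nat, phi^`(n) x = 0).

Let v x := V (- x).
Let psi x := v x * phi^`() x + W (- x) * phi x - c * (v x * phi x).
Let dpsi x := v x * phi^`(2) x - c * (v x * phi^`() x) + chord_cut f s1 (v x) * phi x.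

Let psi_d (x : R) : is_derive x 1 psi (dpsi x).
Proof.
have [Vd Wd _ _ _] := VW.
have vd : is_derive x 1 v (- W (- x)).
  have := @is_derive1_comp _ V -%R x _ _ (Vd (- x)) (is_deriveNid x 1).
  by rewrite mulrN1.
have wd : is_derive x 1 (fun x => W (- x)) (- (c * W (- x) - chord_cut f s1 (v x))).
  have := @is_derive1_comp _ W -%R x _ _ (Wd (- x)) (is_deriveNid x 1).
  by rewrite mulrN1.
have p0 := smooth_derive phi_smooth 0 x; have p1 := smooth_derive phi_smooth 1 x.
apply: is_derive_replace (is_derive_sub (is_derive_add (is_derive_mul vd p1)
  (is_derive_mul wd p0)) (is_derive_mull c (is_derive_mul vd p0))) _.
by rewrite /dpsi/=; ring.
Qed.

Lemma tested_front_equation :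
  (\int[leb]_x (front_profile x * phi^`(2) x - c * (front_profile x * phi^`() x)
     + f (front_profile x) * phi x)%:E
   = (- (v a * phi^`() a + W (- a) * phi a - c * (v a * phi a)))%:E
     + \int[leb]_x (phi x * front_source x)%:E)%E.
Proof.
have vc : continuous v.
  by move=> x; apply: continuous_comp; [exact: oppr_continuous|exact: Vc].
have pc n := smooth_continuous phi_smooth n.
have mD : measurable (`[a, B]%classic : set R) by exact: measurable_itv.
have off x : ~ `[a, B]%classic x -> x < a \/ B <= x.
  move=> /=; rewrite in_itv/= => /negP; rewrite negb_and -!ltNge => /orP[|/ltW]; by [left|right].
have prof0 x : v x <= 0 -> front_profile x = 0.
  by move=> vx; rewrite /front_profile; apply/max_idPr.
have prof1 x : 0 <= v x -> front_profile x = v x.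
  by move=> vx; rewrite /front_profile; apply/max_idPl.
rewrite (integral_vanish_off mD); last first.
  move=> x /off[xa|Bx].
    have [vx|px] := off_a xa; first by rewrite prof0// f0; ring.
    have p0 : phi x = 0 := px 0%N; have p1 : phi^`() x = 0 := px 1%N.
    by rewrite (px 2) p1 p0; ring.
  have p0 : phi x = 0 := phiB 0%N Bx; have p1 : phi^`() x = 0 := phiB 1%N Bx.
  by rewrite (phiB 2)// p1 p0; ring.
rewrite [X in (_ + X)%E](integral_vanish_off mD); last first.
  move=> x /off[xa|Bx]; last by rewrite (phiB 0%N Bx : phi x = 0) mul0r.
  have [vx|px] := off_a xa; first by rewrite front_source_neg// mulr0.
  by rewrite (px 0%N : phi x = 0) mul0r.
have dpsi_c : continuous dpsi.
  move=> x; apply: cvgD; [apply: cvgB|].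
  - by apply: cvgM; [exact: vc|exact: (pc 2)].
  - by apply: cvgM; [exact: cvg_cst|apply: cvgM; [exact: vc|exact: (pc 1%N)]].
  - apply: cvgM; last exact: (pc 0%N).
    by apply: (@continuous_comp _ _ _ v (chord_cut f s1)); [exact: vc|exact: Fc].
have src_c : continuous (fun x => phi x * front_source x).
  by move=> x; apply: cvgM; [exact: (pc 0%N)|exact: front_source_continuous].
transitivity (\int[leb]_(x in `[a, B]) ((dpsi x)%:E + (phi x * front_source x)%:E))%E.
  apply: eq_integral => x; rewrite inE/= in_itv/= => /andP[ax _].
  have vx : 0 <= v x by rewrite (le_trans Va)// Vnincr// lerN2.
  rewrite -EFinD prof1// front_source_pos// /dpsi /v /=; congr EFin; ring.
rewrite integralD//; [|exact: continuous_integrable|exact: continuous_integrable].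
congr (_ + _)%E.
rewrite (@continuous_FTC2 _ dpsi psi a B)//.
- have p0 : phi B = 0 := phiB 0%N (lexx B).
  have p1 : phi^`() B = 0 := phiB 1%N (lexx B).
  by rewrite -EFinB /psi p0 p1; congr EFin; ring.
- exact: continuous_subspaceT.
- split.
  + by move=> x _; exact: ex_derive.
  + apply: cvg_at_right_filter; exact: (is_derive_continuous (psi_d a)).
  + apply: cvg_at_left_filter; exact: (is_derive_continuous (psi_d B)).
- by move=> x _; rewrite derive1E; exact: derive_val.
Qed.

End TestedEquation.

Lemma C_min_front (p a : R) : 0 <= p ->
  front_profile x @[x --> -oo] --> (0 : R) ->
  (forall phi, test_function phi -> (\int[leb]_x
     (front_profile x * phi^`(2) x - c * (front_profile x * phi^`() x)
     + f (front_profile x) * phi x)%:E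
   = (p * phi a)%:E + \int[leb]_x (phi x * front_source x)%:E)%E) ->
  (C_min f c <= p%:E + \int[leb]_x (front_source x)%:E)%E.
Proof.
move=> p0 UN eqn.
have [mu [muT muE]] := point_mass_density a p0 front_source_ge0 front_source_integrable.
rewrite -muT; apply: ereal_inf_lbound; exists mu => //.
exists front_profile; split => //.
- exact: front_profile_homo.
- move=> phi tphi; rewrite eqn//.
  have [phis [A phiA]] := tphi.
  have pc : continuous phi := @smooth_continuous _ _ phis 0%N.
  have A0 : - `|A| <= `|A| by rewrite (@le_trans _ _ 0)// oppr_le0.
  have [|m _ mP] := @EVT_max _ (fun x => `|phi x|) _ _ A0.
    by apply: continuous_subspaceT => x; apply: cvg_norm; exact: pc.
  rewrite -(muE phi `|phi m|)// => x.
  have [xA|xA] := leP `|x| `|A|; first by apply: mP; rewrite in_itv/= -ler_norml.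
  by rewrite phiA ?normr0// (le_lt_trans (ler_norm A)).
- exact: front_profile_cvgy.
Qed.

(** When the front reaches [0] at a finite place it is cut there, which costs
    a point mass equal to its slope. *)
Lemma C_min_front_hit T : 0 < T -> V T = 0 ->
  (C_min f c <= (- W T)%:E + \int[leb]_x (front_source x)%:E)%E.
Proof.
move=> T0 VT; have W_lt0 : forall t, W t < 0 by case: VW.
apply: (@C_min_front _ (- T)); first by rewrite oppr_ge0 ltW.
  by apply: front_profile_cvgNy => e e0; exists T; rewrite ?VT// ltW.
move=> phi [phis [A phiA]].
have := @tested_front_equation phi (- T) (`|A| + 1) phis.
move=> -> //.
- by congr (_ + _)%E; rewrite opprK VT; congr EFin; ring.
- by rewrite (@lt_le_trans _ _ 0) ?oppr_lt0// addr_ge0.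
- move=> n x Ax; apply: (smooth_vanish phis phiA).
  by have := ler_norm A; have := ler_norm x; lra.
- by rewrite opprK VT.
- by move=> x xT; left; rewrite -VT Vnincr// lerNr ltW.
Qed.

(** Nothing is cut: with [a] to the left of the support of [phi], the boundary
    term vanishes. *)
Lemma C_min_front_positive : (forall t, 0 < V t) ->
  (C_min f c <= \int[leb]_x (front_source x)%:E)%E.
Proof.
move=> Vpos; rewrite -[leRHS]add0e.
apply: (@C_min_front _ 0) => //.
  exact: front_profile_cvgNy (reversed_front_vanish fmono s01 VW Vpos).
move=> phi [phis [A phiA]].
have phi0 (n : nat) (x : R) : `|A| + 1 <= `|x| -> phi^`(n) x = 0.
  move=> Ax; apply: (smooth_vanish phis phiA).
  by have := ler_norm A; lra.
have NA : `|- (`|A| + 1)| = `|A| + 1 by rewrite normrN ger0_norm// addr_ge0.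
have := @tested_front_equation phi (- (`|A| + 1)) (`|A| + 1) phis.
move=> -> //.
- have p0 : phi (- (`|A| + 1)) = 0 by apply: (phi0 0%N); rewrite NA.
  have p1 : phi^`() (- (`|A| + 1)) = 0 by apply: (phi0 1%N); rewrite NA.
  by rewrite p0 p1; congr (_ + _)%E; congr EFin; ring.
- have := normr_ge0 A; lra.
- by move=> n x Ax; apply: phi0; rewrite (le_trans Ax)// ler_norm.
- by rewrite ltW.
- move=> x xA; right => n; apply: phi0.
  by have := ler_norm (- x); rewrite normrN; lra.
Qed.

End UpperBound.

(** * Calibrations *)

Section ClipExtension.
Context {R : realType}.

Lemma continuous_within_comp (S T U : topologicalType) (A : set T)
    (h : T -> U) (g : S -> T) :
  {within A, continuous h} -> continuous g -> (forall x, A (g x)) ->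
  continuous (h \o g).
Proof.
move=> /subspace_continuousP hA gc gA x N /= hN.
have := hA (g x) (gA x) N hN; move=> /(gc x) hgN.
have {}hgN : \forall y \near x, A (g y) -> N (h (g y)) := hgN.
suff : \forall y \near x, N (h (g y)) by [].
by apply: filterS hgN => y; apply; exact: gA.
Qed.

End ClipExtension.

Section Calibration.
Context {R : realType}.
Variables (f : R -> R) (c : R).
Hypothesis fmono : monostable f.

(** The last inequality is what makes [phi (u) z] dominate a divergence, whatever
    the value [xi] of the derivative of [u] in [x1]. *)
Definition calibration (phi dphi B dB : R -> R) := [/\
  forall s : R, is_derive s 1 phi (dphi s), continuous dphi,
  forall s : R, is_derive s 1 B (dB s), continuous dB &
  forall s, 0 <= s <= 1 -> [/\ 0 <= phi s <= 1, dphi s <= 0 &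
    forall xi, 0 <= phi s * f s - dphi s * xi ^+ 2 + (c * phi s + dB s) * xi]].

Let fc : continuous f.
Proof. by move=> x; exact: is_derive_continuous (monostable_derive fmono x). Qed.

Let g s := f (clip 0 1 s).

Let gE s : 0 <= s <= 1 -> g s = f s.
Proof. by move=> s01; rewrite /g clip_id. Qed.

Let g_ge0 s : 0 <= g s.
Proof. exact: (monostable_ge0 fmono (clip_bounds s ler01)). Qed.

Let g_cont : continuous g.
Proof.
by move=> x; apply: (@continuous_comp _ _ _ (clip 0 1) f); [exact: clip_continuous|exact: fc].
Qed.

(** The choice of [dphi] and [dB] makes the quadratic form in [xi] equal to
    [phi f (1 - k xi)^2]. *)
Lemma calibration_exists (k : R -> R) : continuous k ->
  exists phi B : R -> R, let dphi s := - (g s * k s ^+ 2 * phi s) in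
  let dB s := - (phi s * (c + 2 * g s * k s)) in
  phi 0 = 1 /\ calibration phi dphi B dB.
Proof.
move=> kc.
have [|A [A0 Ad]] := @antiderivative _ (fun s => g s * k s ^+ 2).
  move=> s; apply: cvgM; first exact: g_cont.
  by rewrite expr2; apply: cvgM; exact: kc.
pose phi s := expR (- A s).
have phid (s : R) : is_derive s 1 phi (- (g s * k s ^+ 2 * phi s)).
  apply: is_derive_replace (@is_derive1_comp _ expR (fun s => - A s) _ _ _ _
    (is_deriveN (Ad s))) _.
  by rewrite /phi; ring.
have phic : continuous phi by move=> s; exact: is_derive_continuous (phid s).
have dBc : continuous (fun s => - (phi s * (c + 2 * g s * k s))).
  move=> s; apply: cvgN; apply: cvgM; first exact: phic.
  apply: cvgD; first exact: cvg_cst.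
  apply: cvgM; last exact: kc.
  by apply: cvgM; [exact: cvg_cst|exact: g_cont].
have [B [_ Bd]] := antiderivative dBc.
exists phi, B => dphi dB; split; first by rewrite /phi A0 oppr0 expR0.
split => //.
  move=> s; apply: cvgN; apply: cvgM; last exact: phic.
  by apply: cvgM; [exact: g_cont|rewrite expr2; apply: cvgM; exact: kc].
move=> s s01; have /andP[s0 s1] := s01; split.
- rewrite expR_ge0/= -expR0 ler_expR oppr_le0 -A0.
  apply: (derive_ge0_le s0 (fun x _ => Ad x)) => x _.
  exact: mulr_ge0 (g_ge0 _) (sqr_ge0 _).
- rewrite oppr_le0.
  exact: mulr_ge0 (mulr_ge0 (g_ge0 _) (sqr_ge0 _)) (expR_ge0 _).
- move=> xi; rewrite /dphi /dB gE//.
  rewrite [leRHS](_ : _ = phi s * (f s * (1 - k s * xi) ^+ 2)); last by ring.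
  by rewrite -gE//; exact: mulr_ge0 (expR_ge0 _) (mulr_ge0 (g_ge0 _) (sqr_ge0 _)).
Qed.

Variables (s1 lam T : R) (V W : R -> R).
Hypothesis s01 : 0 < s1 < 1.
Hypothesis lam_gt0 : 0 < lam.
Hypothesis VW : reversed_front f s1 c lam V W.
Hypothesis T0 : 0 < T.
Hypothesis VT : V T = 0.

Let s1_gt0 : 0 < s1. Proof. by case/andP: s01. Qed.
Let s1_lt1 : s1 < 1. Proof. by case/andP: s01. Qed.

(** The front is strictly monotone with a slope that never vanishes, so the
    reciprocal of its slope is a continuous function of its height, extended by
    constants beyond the heights it takes. *)
Lemma front_inverse_slope : exists k : R -> R, [/\ continuous k,
  forall s, 0 <= k s & forall t, 0 <= t <= T -> k (V t) = - (W t)^-1].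
Proof.
have V0 := reversed_front0 VW.
have Vd := reversed_front_decr VW; have Vn := reversed_front_nincr VW.
have [X XV] : exists X : R -> R, forall t, X (V t) = t.
  have /choice[X XP] : forall s, exists t, (exists t', V t' = s) -> V t = s.
    move=> s; have [[t Vt]|nt] := pselect (exists t', V t' = s); first by exists t.
    by exists 0.
  exists X => t; have := XP (V t) (ex_intro _ t erefl).
  have [/Vd|/Vd|//] := ltgtP (X (V t)) t.
  - by move=> /[swap] ->; rewrite ltxx.
  - by move=> /[swap] ->; rewrite ltxx.
have Xc : {within `[0, s1], continuous X}.
  have := @segment_can_ge_continuous _ 0 T V X (ltW T0).
  rewrite VT V0; apply => [|t _]; last exact: XV.
  by apply: continuous_subspaceT; exact: reversed_front_continuous VW.
case: VW => _ Wd _ _ W_lt0.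
exists (fun s => - (W (X (clip 0 s1 s)))^-1); split.
- have Xcc : continuous (X \o clip 0 s1).
    apply: continuous_within_comp Xc _ _; first exact: clip_continuous.
    by move=> s /=; rewrite in_itv/=; apply: clip_bounds; exact: ltW.
  move=> s; apply: cvgN; apply: cvgV; first by rewrite lt_eqF.
  apply: (@continuous_comp _ _ _ (X \o clip 0 s1) W); first exact: Xcc.
  exact: is_derive_continuous (Wd _).
- by move=> s; rewrite oppr_ge0 invr_le0 ltW.
- move=> t /andP[t0 tT]; rewrite clip_id ?XV// -VT -V0.
  by rewrite !Vn.
Qed.

(** With [1 / k] the slope of the front, [B (V) + phi (V) W] is constant along it,
    which gives [B 0 - B s1] exactly.  Between [s1] and [1] only the bounds
    [0 <= phi <= 1] and [0 <= k] are used, at a cost of order [1 - s1]. *)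
Lemma front_calibration : exists phi dphi B dB : R -> R,
  calibration phi dphi B dB /\
  - W T - (1 - s1) * lam - `|c| * (1 - s1) <= B 0 - B 1.
Proof.
have [k [kc k0 kV]] := front_inverse_slope.
have [phi [B [phi0 cal]]] := calibration_exists kc.
exists phi; eexists; exists B; eexists; split; first exact: cal.
case: cal => phid _ Bd _ cal.
have V0 := reversed_front0 VW; have Vn := reversed_front_nincr VW.
have [Vd Wd _ W0 W_lt0] := VW.
have Dd (t : R) : 0 <= t <= T ->
    is_derive t 1 (fun t => B (V t) + phi (V t) * W t) (cst 0 t).
  move=> /[dup] t0T /andP[t0 tT].
  have Vt0 : 0 <= V t by rewrite -VT Vn.
  have Vts : V t <= s1 by rewrite -V0 Vn.
  apply: is_derive_replace (is_derive_add
    (@is_derive1_comp _ B V _ _ _ (Bd _) (Vd t))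
    (is_derive_mul (@is_derive1_comp _ phi V _ _ _ (phid _) (Vd t)) (Wd t))) _.
  rewrite kV// chord_cut_lower ?Vt0// gE; last by rewrite Vt0 (le_trans Vts)// ltW.
  by rewrite /=; field; rewrite lt_eqF.
have := derive_eq0_eq (ltW T0) Dd (fun _ _ => erefl).
rewrite V0 VT W0 phi0 mul1r => D0T.
have s101 : 0 <= s1 <= 1 by rewrite !ltW.
have [/andP[ps0 ps1] _ _] := cal _ s101.
have [x /andP[sx x1] BE] := MVT_closed s1_lt1 (fun x _ => Bd x).
have x01 : 0 <= x <= 1 by rewrite !ltW// (lt_trans s1_gt0).
have [/andP[px0 px1] _ _] := cal _ x01.
have h1 : phi s1 * ((1 - s1) * lam) <= (1 - s1) * lam.
  by rewrite ler_piMl// mulr_ge0 ?subr_ge0 ?ltW.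
have h2 : - (`|c| * (1 - s1)) <= phi x * (c + 2 * g x * k x) * (1 - s1).
  rewrite -mulNr ler_wpM2r ?subr_ge0 ?(ltW s1_lt1)// mulrDr.
  apply: (@le_trans _ _ (phi x * c)); last by rewrite lerDl !mulr_ge0.
  have : `|phi x * c| <= `|c| by rewrite normrM ger0_norm// ler_piMl.
  by rewrite ler_norml => /andP[].
lra.
Qed.

End Calibration.

(** * Integration on rectangles of the plane *)

Section PlaneMeasure.
Context {R : realType}.
Notation leb := (@lebesgue_measure R).
Notation TR := (measurableTypeR R).

(** An open set is a countable union of boxes with rational centres, so the Borel
    sets of the plane belong to the product of the Borel sets of the lines. *)
Lemma open_measurable_plane (O : set (R * R)) : open O ->
  measurable (O : set (TR * TR)).
Proof.
move=> oO.
pose box (q1 q2 : rat) (n : nat) : set (TR * TR) :=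
  ball (ratr q1 : R) n.+1%:R^-1 `*` ball (ratr q2 : R) n.+1%:R^-1.
pose good q1 q2 n := `[< box q1 q2 n `<=` O >].
have -> : O = \bigcup_q1 \bigcup_q2 \bigcup_n (if good q1 q2 n then box q1 q2 n else set0).
  apply/seteqP; split; last first.
    move=> p [q1 _ [q2 _ [n _]]]; case: ifPn => // /asboolP; exact.
  move=> [x y] Oxy; have /nbhs_ballP[e /= e0 eO] := open_nbhs_nbhs (conj oO Oxy).
  have e20 : 0 < e / 2 by rewrite divr_gt0.
  have [n nP] : exists n : nat, n.+1%:R^-1 < e / 2.
    near \oo => n; exists n.
    by near: n; exact: (near_infty_natSinv_lt (PosNum e20)).
  set r : R := n.+1%:R^-1 in nP *.
  have r0 : 0 < r by rewrite /r invr_gt0.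
  have near_rat (t : R) : exists q : rat, ball (ratr q : R) r t.
    have /rat_in_itvoo[q] : t - r < t + r by lra.
    rewrite in_itv/= => /andP[h1 h2]; exists q.
    by rewrite -ball_normE/= ltr_norml; apply/andP; split; lra.
  have [q1 q1x] := near_rat x; have [q2 q2y] := near_rat y.
  exists q1 => //; exists q2 => //; exists n => //.
  rewrite ifT; first by split.
  apply/asboolP => -[s t] []; rewrite /= -/r => sq tq; apply: eO; split => /=.
    move: q1x sq; rewrite -!ball_normE/= !ltr_norml => /andP[? ?] /andP[? ?].
    by apply/andP; split; lra.
  move: q2y tq; rewrite -!ball_normE/= !ltr_norml => /andP[? ?] /andP[? ?].
  by apply/andP; split; lra.
apply: bigcupT_measurable_rat => q1; apply: bigcupT_measurable_rat => q2.
apply: bigcupT_measurable => n; case: ifPn => // _.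
by apply: measurableX; exact: measurable_ball.
Unshelve. all: by end_near. Qed.

Lemma continuous_measurable_plane (w : R * R -> R) : continuous w ->
  measurable_fun (setT : set (TR * TR)) (w : TR * TR -> R).
Proof.
move=> /continuousP wc; apply: (measurability _ (RGenOpens.measurableE R)).
move=> _ [_ [a [b ->] <-]]; rewrite setTI.
by apply: open_measurable_plane; apply: wc; exact: interval_open.
Qed.

Notation lebp := (leb \x leb)%E.

Definition rectangle (a b c d : R) : set (TR * TR) := `[a, b] `*` `[c, d].

Lemma measurable_rectangle a b c d : measurable (rectangle a b c d).
Proof. by apply: measurableX; exact: measurable_itv. Qed.

Lemma rectangle_measure a b c d : a <= b -> c <= d ->
  lebp (rectangle a b c d) = ((b - a) * (d - c))%:E.
Proof.
move=> ab cd; rewrite /rectangle product_measure1E; [|exact: measurable_itv..].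
have len (s t : R) : s <= t -> leb `[s, t]%classic = (t - s)%:E.
  move=> st; rewrite lebesgue_measure_itv/= lte_fin.
  move: st; rewrite le_eqVlt => /predU1P[->|st]; first by rewrite ltxx subrr.
  by rewrite st -EFinB.
transitivity (leb `[a, b]%classic * leb `[c, d]%classic)%E; first by [].
by rewrite !len// -EFinM.
Qed.

Lemma rectangle_bounded (w : R * R -> R) a b c d : continuous w ->
  exists M, forall p, rectangle a b c d p -> `|w p| <= M.
Proof.
move=> wc; have cR : compact (rectangle a b c d : set (R * R)).
  by apply: compact_setX; exact: segment_compact.
have cw : compact ((fun p : R * R => `|w p|) @` (rectangle a b c d)).
  apply: continuous_compact => //; apply: continuous_subspaceT => p.
  by apply: cvg_norm; exact: wc.
have [M [_ MP]] := compact_bounded cw.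
exists (M + 1) => p Rp; have := MP (M + 1); rewrite ltrDl ltr01 => /(_ isT).
by move=> /(_ (`|w p|)); rewrite /= normr_id; apply; exists p.
Qed.

Lemma rectangle_integrable (w : R * R -> R) a b c d : continuous w ->
  a <= b -> c <= d -> lebp.-integrable (rectangle a b c d) (EFin \o w).
Proof.
move=> wc ab cd; have [M MP] := rectangle_bounded a b c d wc.
have mr := measurable_rectangle a b c d.
apply: (@le_integrable _ _ _ lebp _ mr _ (EFin \o cst M)).
- by apply/measurable_EFinP; apply: measurable_funTS; exact: continuous_measurable_plane.
- by move=> p Rp /=; rewrite lee_fin (le_trans (MP p Rp))// ler_norm.
- apply/integrableP; split; first exact/measurable_EFinP.
  rewrite /= integral_cst//= rectangle_measure// -EFinM; exact: ltry.
Qed.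

Lemma rectangle_restrict (w : R * R -> R) a b c d (p : R * R) :
  ((EFin \o w) \_ (rectangle a b c d)) p =
  ((fun x => ((fun y => (w (x, y))%:E) \_ `[c, d]) p.2) \_ `[a, b]) p.1.
Proof.
rewrite !patchE /rectangle in_setX; case: p => x y /=.
by do 2 case: (_ \in _).
Qed.

Lemma rectangle_integral12 (w : R * R -> R) a b c d : continuous w ->
  a <= b -> c <= d ->
  (\int[lebp]_(p in rectangle a b c d) (w p)%:E =
   \int[leb]_(x in `[a, b]) \int[leb]_(y in `[c, d]) (w (x, y))%:E)%E.
Proof.
move=> wc ab cd; have mr := measurable_rectangle a b c d.
have iw := rectangle_integrable wc ab cd.
move/(integrable_mkcond _ mr) : (iw) => iwT.
rewrite integral_mkcond -integral12_prod_meas1//.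
rewrite [RHS]integral_mkcond; apply: eq_integral => x _; rewrite /fubini_F.
under eq_integral do rewrite rectangle_restrict.
rewrite patchE; case: ifPn => xab /=.
  rewrite [RHS]integral_mkcond; apply: eq_integral => y _.
  by rewrite [LHS]patchE xab.
by apply: integral0_eq => y _; rewrite [LHS]patchE (negbTE xab).
Qed.

Lemma rectangle_integral21 (w : R * R -> R) a b c d : continuous w ->
  a <= b -> c <= d ->
  (\int[lebp]_(p in rectangle a b c d) (w p)%:E =
   \int[leb]_(y in `[c, d]) \int[leb]_(x in `[a, b]) (w (x, y))%:E)%E.
Proof.
move=> wc ab cd; have mr := measurable_rectangle a b c d.
have iw := rectangle_integrable wc ab cd.
move/(integrable_mkcond _ mr) : (iw) => iwT.
rewrite integral_mkcond -integral21_prod_meas1//.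
rewrite [RHS]integral_mkcond; apply: eq_integral => y _; rewrite /fubini_G.
under eq_integral do rewrite rectangle_restrict.
rewrite patchE; case: ifPn => ycd /=.
  rewrite [RHS]integral_mkcond; apply: eq_integral => x _.
  by rewrite !patchE ycd.
by apply: integral0_eq => x _; rewrite !patchE (negbTE ycd); case: ifP.
Qed.

Lemma rectangle_section_integrable (w : R * R -> R) a b c d : continuous w ->
  a <= b -> c <= d ->
  leb.-integrable `[a, b] (fun x => \int[leb]_(y in `[c, d]) (w (x, y))%:E)%E.
Proof.
move=> wc ab cd; have mr := measurable_rectangle a b c d.
have iw := rectangle_integrable wc ab cd.
move/(integrable_mkcond _ mr) : (iw) => iwT.
have mab : measurable (`[a, b]%classic : set TR) by exact: measurable_itv.
have := integrableS measurableT mab (@subsetT _ _) (integrable_fubini_F iwT).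
apply: eq_integrable => // x xab; rewrite /fubini_F.
under eq_integral do rewrite rectangle_restrict.
rewrite [RHS]integral_mkcond; apply: eq_integral => y _.
by rewrite [LHS]patchE xab.
Qed.

(** Some slice of a continuous function is at least its average over a strip
    of width one, up to an arbitrarily small loss. *)
Lemma mean_slice (w : R * R -> R) (a s t e : R) : continuous w -> s <= t -> 0 < e ->
  exists2 b, a <= b <= a + 1 &
    (\int[lebp]_(p in rectangle a (a + 1) s t) (w p)%:E - e%:E <=
     \int[leb]_(y in `[s, t]) (w (b, y))%:E)%E.
Proof.
move=> wc st e0; have aa : a <= a + 1 by lra.
have iw := rectangle_integrable wc aa st.
have fI := integrable_fin_num (measurable_rectangle a (a + 1) s t) iw.
have [r IE] : exists r : R,
    (\int[lebp]_(p in rectangle a (a + 1) s t) (w p)%:E)%E = r%:E.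
  by exists (fine (\int[lebp]_(p in rectangle a (a + 1) s t) (w p)%:E)%E); rewrite fineK.
rewrite IE.
apply: contrapT => noslice.
have lt x : a <= x <= a + 1 ->
    (\int[leb]_(y in `[s, t]) (w (x, y))%:E <= (r - e)%:E)%E.
  move=> xa; rewrite leNgt; apply/negP => Ix; apply: noslice; exists x => //.
  by rewrite -EFinB ltW.
have : (r%:E <= \int[leb]_(x in `[a, (a + 1)%R]) (r - e)%:E)%E.
  rewrite -IE (rectangle_integral12 wc aa st); apply: le_integral => //.
  - exact: rectangle_section_integrable.
  - by apply: continuous_integrable => x; exact: cvg_cst.
  - by move=> x; rewrite inE/= in_itv/= => xa; exact: lt.
rewrite integral_cst//= lebesgue_measure_itv/= lte_fin ltrDl ltr01 -EFinB.
rewrite -EFinM lee_fin; lra.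
Qed.

End PlaneMeasure.

(** * The flux inequality in the strip *)

Section Slices.
Context {R : realType}.
Implicit Types w : R * R -> R.

Lemma derivable_slice1 w (x y : R) : derivable w (x, y) (e1 R) ->
  is_derive x 1 (fun t => w (t, y)) (d1 w (x, y)).
Proof.
have E : (fun h : R => h^-1 *: (w (h *: e1 R + (x, y)) - w (x, y))) =
         (fun h : R => h^-1 *: (w (h *: 1 + x, y) - w (x, y))).
  apply/funext => h; congr (_ *: (w _ - _)).
  by rewrite /e1; congr (_, _); rewrite /= [h *: 0]mulr0 add0r.
rewrite /derivable E => wd; apply: DeriveDef; first exact: wd.
by rewrite /d1 /derive E.
Qed.

Lemma derivable_slice2 w (x y : R) : derivable w (x, y) (e2 R) ->
  is_derive y 1 (fun t => w (x, t)) (d2 w (x, y)).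
Proof.
have E : (fun h : R => h^-1 *: (w (h *: e2 R + (x, y)) - w (x, y))) =
         (fun h : R => h^-1 *: (w (x, h *: 1 + y) - w (x, y))).
  apply/funext => h; congr (_ *: (w _ - _)).
  by rewrite /e2; congr (_, _); rewrite /= [h *: 0]mulr0 add0r.
rewrite /derivable E => wd; apply: DeriveDef; first exact: wd.
by rewrite /d2 /derive E.
Qed.

Lemma continuous_pair (S : topologicalType) (g h : S -> R) :
  continuous g -> continuous h -> continuous (fun q => (g q, h q)).
Proof. by move=> gc hc q; exact: (cvg_pair (gc q) (hc q)). Qed.

Definition clip_strip (a b : R) (p : R * R) : R * R := (p.1, clip a b p.2).

Lemma clip_strip_continuous a b : continuous (clip_strip a b).
Proof.
apply: continuous_pair => p; first exact: cvg_fst.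
by apply: (@continuous_comp _ _ _ snd (clip a b)); [exact: cvg_snd|exact: clip_continuous].
Qed.

Lemma band_sub01 (s y : R) : 0 < s -> s <= y <= 1 - s -> 0 <= y <= 1.
Proof. by move=> s0 /andP[? ?]; apply/andP; split; lra. Qed.

Lemma clip_strip_id a b x y : a <= y <= b -> clip_strip a b (x, y) = (x, y).
Proof. by move=> ab; rewrite /clip_strip/= clip_id. Qed.

Notation leb := (@lebesgue_measure R).

(** Both ends of a rectangle at once: [p1] and [p2] are exchanged for [q1] and
    [q2] at a loss of [e] each. *)
Lemma integral_sum_transfer (a b e d k : R) (p1 p2 q1 q2 r : R -> R) :
  continuous p1 -> continuous p2 -> continuous q1 -> continuous q2 -> continuous r ->
  (\int[leb]_(y in `[a, b]) (p1 y)%:E - e%:E <= \int[leb]_(y in `[a, b]) (q1 y)%:E)%E ->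
  (\int[leb]_(y in `[a, b]) (p2 y)%:E - e%:E <= \int[leb]_(y in `[a, b]) (q2 y)%:E)%E ->
  d + 2 * e <= k ->
  (\int[leb]_(y in `[a, b]) (p1 y + (p2 y + r y))%:E - k%:E
   <= \int[leb]_(y in `[a, b]) (q1 y + (q2 y + r y))%:E - d%:E)%E.
Proof.
move=> p1c p2c q1c q2c rc.
pose J g := \int[leb]_(y in `[a, b]) (g y).
have JE (g : R -> R) : continuous g -> (\int[leb]_(y in `[a, b]) (g y)%:E = (J g)%:E)%E.
  move=> gc; rewrite /J /Rintegral fineK//.
  by apply: integrable_fin_num => //; exact: continuous_integrable.
have JD (g h : R -> R) : continuous g -> continuous h ->
    J (fun y => g y + h y) = J g + J h.
  by move=> gc hc; apply: RintegralD => //; exact: continuous_integrable.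
have addc (g h : R -> R) : continuous g -> continuous h -> continuous (fun y => g y + h y).
  by move=> gc hc y; apply: cvgD; [exact: gc|exact: hc].
rewrite !JE//; do ?[exact: addc|apply: (addc _ _ _ (addc _ _ _ _)) => //].
rewrite !JD//; do ?exact: addc.
rewrite -!EFinB !lee_fin; lra.
Qed.

End Slices.

Section Strip.
Context {R : realType}.
Notation leb := (@lebesgue_measure R).
Notation lebp := (leb \x leb)%E.
Variables (f phi dphi B dB : R -> R) (c : R) (u z : R * R -> R).
Hypothesis cal : calibration f c phi dphi B dB.
Hypothesis u01 : forall p, closed_strip p -> 0 <= u p <= 1.
Hypothesis z0 : forall p, closed_strip p -> 0 <= z p.
Hypothesis z_smooth : smooth_source z.
Hypothesis u_sol : strip_solution f c z u.
Hypothesis u_lim : front_limits u.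

Let open_closed (p : R * R) : open_strip p -> closed_strip p.
Proof. by move=> /andP[? ?]; apply/andP; split; exact: ltW. Qed.

Let u_part (s : seq bool) (p : R * R) : (size s <= 2)%N -> open_strip p ->
  {for p, continuous (partials s u)}.
Proof. by move=> s2 op; case: u_sol => uC _ _ _; case: (uC s s2 p op). Qed.

Let u_part_d (s : seq bool) (x y : R) : (size s < 2)%N -> open_strip (x, y) ->
  is_derive x 1 (fun t => partials s u (t, y)) (d1 (partials s u) (x, y)) /\
  is_derive y 1 (fun t => partials s u (x, t)) (d2 (partials s u) (x, y)).
Proof.
move=> s2 op; case: u_sol => uC _ _ _.
have [_ /(_ s2) [h1 h2]] := uC s (ltnW s2) (x, y) op.
by split; [exact: derivable_slice1|exact: derivable_slice2].
Qed.

(** The two components of the flux whose divergence is bounded by [z]. *)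
Let F p := phi (u p) * d1 u p - B (u p).
Let G p := phi (u p) * d2 u p.
Let dF p := dphi (u p) * d1 u p ^+ 2 + phi (u p) * d1 (d1 u) p - dB (u p) * d1 u p.
Let dG p := dphi (u p) * d2 u p ^+ 2 + phi (u p) * d2 (d2 u) p.

Let F_derive x y : open_strip (x, y) ->
  is_derive x 1 (fun t => F (t, y)) (dF (x, y)).
Proof.
move=> op; have [phid _ Bd _ _] := cal.
have [ud _] := @u_part_d [::] x y isT op.
have [udd _] := @u_part_d [:: false] x y isT op.
apply: is_derive_replace (is_derive_sub (is_derive_mul
  (@is_derive1_comp _ phi (fun t => u (t, y)) _ _ _ (phid _) ud) udd)
  (@is_derive1_comp _ B (fun t => u (t, y)) _ _ _ (Bd _) ud)) _.
rewrite /dF/=; ring.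
Qed.

Let G_derive x y : open_strip (x, y) ->
  is_derive y 1 (fun t => G (x, t)) (dG (x, y)).
Proof.
move=> op; have [phid _ Bd _ _] := cal.
have [_ ud] := @u_part_d [::] x y isT op.
have [_ udd] := @u_part_d [:: true] x y isT op.
apply: is_derive_replace (is_derive_mul
  (@is_derive1_comp _ phi (fun t => u (x, t)) _ _ _ (phid _) ud) udd) _.
rewrite /dG/=; ring.
Qed.

(** The calibration inequality with [xi] the derivative in [x1].  The square of the
    derivative in [x2] comes with the factor [phi' <= 0]. *)
Let flux_le p : open_strip p -> dF p + dG p <= z p.
Proof.
move=> op; have [_ _ _ _ calP] := cal.
have cp := open_closed op.
have [/andP[ph0 ph1] dph0 quad] := calP _ (u01 cp).
have := quad (d1 u p); have zp := z0 cp.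
case: u_sol => _ _ /(_ p op) eqn _; rewrite /laplacian in eqn.
have zE : phi (u p) * z p <= z p by rewrite ler_piMl.
have dq : dphi (u p) * d2 u p ^+ 2 <= 0 by rewrite mulr_le0_ge0 ?sqr_ge0.
have zz : z p = f (u p) + c * d1 u p + (d1 (d1 u) p + d2 (d2 u) p) by lra.
have : phi (u p) * z p = phi (u p) * f (u p) + c * phi (u p) * d1 u p +
  phi (u p) * d1 (d1 u) p + phi (u p) * d2 (d2 u) p by rewrite zz; ring.
rewrite /dF /dG mulrDl; lra.
Qed.

Let cont_comp (h : R -> R) (w : R * R -> R) (p : R * R) : continuous h ->
  {for p, continuous w} -> {for p, continuous (fun q => h (w q))}.
Proof. by move=> hc wc; apply: (@continuous_comp _ _ _ w h); [exact: wc|exact: hc]. Qed.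

Let phi_cont : continuous phi.
Proof. by case: cal => phid _ _ _ _ s; exact: is_derive_continuous (phid s). Qed.

Let B_cont : continuous B.
Proof. by case: cal => _ _ Bd _ _ s; exact: is_derive_continuous (Bd s). Qed.

Let phid1_cont p : open_strip p -> {for p, continuous (fun q => phi (u q) * d1 u q)}.
Proof.
move=> op; apply: cvgM; last exact: (@u_part [:: false] p isT op).
exact: cont_comp phi_cont (@u_part [::] p isT op).
Qed.

Let dF_cont p : open_strip p -> {for p, continuous dF}.
Proof.
move=> op; have [_ dphic _ dBc _] := cal.
have u0 := @u_part [::] p isT op; have u1 := @u_part [:: false] p isT op.
have u11 := @u_part [:: false; false] p isT op.
apply: cvgB; last by apply: cvgM; [exact: cont_comp dBc u0|exact: u1].
apply: cvgD; last by apply: cvgM; [exact: cont_comp phi_cont u0|exact: u11].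
apply: cvgM; first exact: cont_comp dphic u0.
by apply: (@cont_comp (fun s => s ^+ 2) (d1 u)); [exact: exprn_continuous|exact: u1].
Qed.

Let dG_cont p : open_strip p -> {for p, continuous dG}.
Proof.
move=> op; have [_ dphic _ dBc _] := cal.
have u0 := @u_part [::] p isT op; have u2 := @u_part [:: true] p isT op.
have u22 := @u_part [:: true; true] p isT op.
apply: cvgD; last by apply: cvgM; [exact: cont_comp phi_cont u0|exact: u22].
apply: cvgM; first exact: cont_comp dphic u0.
by apply: (@cont_comp (fun s => s ^+ 2) (d2 u)); [exact: exprn_continuous|exact: u2].
Qed.

Let G_cont p : open_strip p -> {for p, continuous G}.
Proof.
move=> op; apply: cvgM; last exact: (@u_part [:: true] p isT op).
exact: cont_comp phi_cont (@u_part [::] p isT op).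
Qed.

Let u_clip_cont : continuous (u \o clip_strip 0 1).
Proof.
case: u_sol => _ [_ uc _] _ _; apply: continuous_within_comp uc _ _.
  exact: clip_strip_continuous.
by move=> p; exact: clip_bounds.
Qed.

(** Continuity on the line [s = s0] is uniform on compact parts of that line. *)
Lemma uniform_near0 (w : R * R -> R) (s0 : R) : continuous w ->
  (forall x, w (x, s0) = 0) -> forall A e : R, 0 < e ->
  \forall s \near s0, forall x, - A <= x <= A -> `|w (x, s)| <= e.
Proof.
move=> wc ws0 A e e0.
have /compact_near_coveringP cov := @segment_compact R (- A) A.
have near0 x : `[- A, A]%classic x ->
    \forall x' \near x & s \near nbhs s0, `|w (x', s)| <= e.
  move=> _; have := wc (x, s0) => /cvgrPdist_le/(_ e e0).
  by rewrite ws0; apply: filterS => -[t s] /=; rewrite sub0r normrN.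
have := cov _ _ (fun s x => `|w (x, s)| <= e) (nbhs_filter s0) near0.
by apply: filterS => s sP x xA; apply: sP; rewrite /= in_itv.
Qed.

(** The one-sided normal derivatives are the boundary values of [d2 u], by the
    mean value theorem. *)
Let boundary_flux : exists2 v : R * R -> R, continuous v &
  (forall x, v (x, 0) = 0 /\ v (x, 1) = 0) /\
  (forall p, open_strip p -> v p = d2 u p).
Proof.
case: u_sol => _ [_ _ [v1 [v [_ vc vE]]]] _ neu.
have vcc : continuous (v \o clip_strip 0 1).
  apply: continuous_within_comp vc _ _; first exact: clip_strip_continuous.
  by move=> p; exact: clip_bounds.
exists (v \o clip_strip 0 1) => //.
have vop p : open_strip p -> (v \o clip_strip 0 1) p = d2 u p.
  case: p => x y op; rewrite /= clip_strip_id; last exact: open_closed op.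
  by have [_ ->] := vE _ op.
split => // x.
pose w y := (u \o clip_strip 0 1) (x, y).
have wE y : 0 <= y <= 1 -> w y = u (x, y) by move=> y01; rewrite /w /= clip_strip_id.
have wc : continuous w.
  move=> y; apply: (@continuous_comp _ _ _ (fun y => (x, y)) (u \o clip_strip 0 1)).
    by apply: continuous_pair => t; [exact: cvg_cst|exact: cvg_id].
  exact: u_clip_cont.
have wd (y : R) : 0 < y < 1 -> is_derive y 1 w (d2 u (x, y)).
  move=> /andP[y0 y1]; have [_ ud] := @u_part_d [::] x y isT (introT andP (conj y0 y1)).
  apply: (near_eq_is_derive _ ud); near=> t.
  apply/esym/wE/andP; split; apply: ltW; near: t; [exact: lt_nbhsr|exact: lt_nbhsl].
have vx_cont : continuous (fun t => (v \o clip_strip 0 1) (x, t)).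
  move=> y; apply: (@continuous_comp _ _ _ (fun y => (x, y)) (v \o clip_strip 0 1)).
    by apply: continuous_pair => t; [exact: cvg_cst|exact: cvg_id].
  exact: vcc.
have mvt (s t : R) : 0 <= s -> s < t -> t <= 1 ->
    exists2 r, s < r < t & w t - w s = (v \o clip_strip 0 1) (x, r) * (t - s).
  move=> s0 st t1.
  have wd' (y : R) : y \in `]s, t[%R -> is_derive y 1 w (d2 u (x, y)).
    rewrite in_itv/= => /andP[sy yt]; apply: wd.
    by rewrite (le_lt_trans s0)//= (lt_le_trans yt).
  have [r rst wE'] := MVT st wd' (continuous_subspaceT wc).
  have /andP[sr rt] : s < r < t by move: rst; rewrite in_itv.
  exists r; first by rewrite sr.
  by rewrite vop//; apply/andP; rewrite (le_lt_trans s0 sr) (lt_le_trans rt t1).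
have small (l : R) : (forall e, 0 < e -> `|l| <= e) -> l = 0.
  move=> le; apply/eqP; rewrite -normr_le0; apply/ler_addgt0Pl => e e0.
  by rewrite addr0 le.
have [neu0 neu1] := neu x.
split; apply: small => e e0.
  have e2 : 0 < e / 2 by rewrite divr_gt0.
  have /cvgrPdist_le/(_ _ e2)[d /= d0 dP] := vx_cont 0.
  have /cvgrPdist_le/(_ _ e2) nq := neu0.
  near (0 : R)^'+ => h.
  have h0 : 0 < h by near: h; exact: nbhs_right_gt.
  have h1 : h < 1 by near: h; exact: nbhs_right_lt.
  have hd : h < d by near: h; exact: nbhs_right_lt.
  have : `|0 - h^-1 * (u (x, h) - u (x, 0))| <= e / 2 by near: h.
  have [r /andP[r0 rh]] := mvt 0 h (lexx 0) h0 (ltW h1).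
  rewrite !wE ?lexx ?ler01 ?(ltW h0) ?(ltW h1)// subr0 => ->.
  rewrite mulrCA mulVf ?gt_eqF// mulr1 sub0r normrN.
  have := dP r; rewrite /= sub0r normrN gtr0_norm// => /(_ (lt_trans rh hd)).
  by rewrite !ler_norml => /andP[? ?] /andP[? ?]; apply/andP; split; lra.
have e2 : 0 < e / 2 by rewrite divr_gt0.
have /cvgrPdist_le/(_ _ e2)[d /= d0 dP] := vx_cont 1.
have /cvgrPdist_le/(_ _ e2) nq := neu1.
near (0 : R)^'- => h.
have h0 : h < 0 by near: h; exact: nbhs_left_lt.
have h1 : -1 < h by near: h; apply: nbhs_left_gt; rewrite ltrN10.
have hd : - d < h by near: h; apply: nbhs_left_gt; rewrite oppr_lt0.
have : `|0 - h^-1 * (u (x, 1 + h) - u (x, 1))| <= e / 2 by near: h.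
have [|||r /andP[r0 rh]] := mvt (1 + h) 1; [lra|lra|lra|].
have E1 : w 1 = u (x, 1) by apply: wE; rewrite ler01 lexx.
have E2 : w (1 + h) = u (x, 1 + h) by apply: wE; apply/andP; split; lra.
rewrite E1 E2 => wE'.
have -> : u (x, 1 + h) - u (x, 1) = (v \o clip_strip 0 1) (x, r) * h.
  by rewrite -[LHS]opprB wE'; ring.
rewrite mulrCA mulVf ?lt_eqF// mulr1 sub0r normrN.
have := dP r; rewrite /= ger0_norm; last lra.
have rd : 1 - r < d by lra.
move=> /(_ rd); rewrite !ler_norml => /andP[? ?] /andP[? ?].
by apply/andP; split; lra.
Unshelve. all: by end_near. Qed.

Let flux_small (A e : R) : 0 < e -> \forall s \near 0^'+, forall x, - A <= x <= A ->
  `|G (x, s)| <= e /\ `|G (x, 1 - s)| <= e.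
Proof.
move=> e0; have [v vc [vb vE]] := boundary_flux.
have vrc : continuous (fun p : R * R => v (p.1, 1 - p.2)).
  move=> p; apply: (@continuous_comp _ _ _ (fun p : R * R => (p.1, 1 - p.2)) v); last exact: vc.
  apply: continuous_pair => q; first exact: cvg_fst.
  by apply: cvgB; [exact: cvg_cst|exact: cvg_snd].
have b0 := uniform_near0 vc (fun x => (vb x).1) A e0.
have b1 : \forall s \near (0 : R), forall x, - A <= x <= A -> `|v (x, 1 - s)| <= e.
  by apply: (uniform_near0 vrc) => // x /=; rewrite subr0; case: (vb x).
have Gv p : open_strip p -> `|G p| <= `|v p|.
  move=> op; have [_ _ _ _ calP] := cal.
  have [/andP[ph0 ph1] _ _] := calP _ (u01 (open_closed op)).
  by rewrite /G vE// normrM ger0_norm// ler_piMl.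
near=> s => x xA.
have s0 : 0 < s by near: s; exact: nbhs_right_gt.
have s1 : s < 1 by near: s; exact: nbhs_right_lt.
have h0 : forall x, - A <= x <= A -> `|v (x, s)| <= e.
  by near: s; apply: cvg_at_right_filter b0; exact: cvg_id.
have h1 : forall x, - A <= x <= A -> `|v (x, 1 - s)| <= e.
  by near: s; apply: cvg_at_right_filter b1; exact: cvg_id.
split.
  by apply: le_trans (h0 x xA); apply: Gv; apply/andP.
by apply: le_trans (h1 x xA); apply: Gv; apply/andP => /=; split; lra.
Unshelve. all: by end_near. Qed.

Let zc p := z (clip_strip 0 1 p).

Let zc_cont : continuous zc.
Proof.
case: z_smooth => _ zw.
have := continuous_within_comp zw (@clip_strip_continuous R 0 1); apply.
by move=> p; exact: clip_bounds.
Qed.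

Let zc_id p : closed_strip p -> zc p = z p.
Proof. by case: p => x y cp; rewrite /zc clip_strip_id. Qed.

Let M : \bar R := (\int[lebp]_(p in closed_strip) `|z p|%:E)%E.

Let strip_ge_rectangle a b s : 0 <= s -> s <= 1 ->
  (\int[lebp]_(p in rectangle a b s (1 - s)) `|zc p|%:E <= M)%E.
Proof.
move=> s0 s1.
have mS : measurable (closed_strip : set (measurableTypeR R * measurableTypeR R)).
  rewrite (_ : closed_strip = setT `*` `[0, 1]%classic).
    by apply: measurableX => //; exact: measurable_itv.
  by apply/seteqP; split => -[x y]; rewrite /closed_strip/= in_itv/=; [|case].
have -> : M = (\int[lebp]_(p in closed_strip) `|zc p|%:E)%E.
  by apply: eq_integral => p; rewrite inE => /zc_id ->.
apply: ge0_subset_integral => //.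
- exact: measurable_rectangle.
- apply/measurable_EFinP; apply: measurableT_comp => //.
  by apply: measurable_funTS; exact: continuous_measurable_plane zc_cont.
- move=> -[x y] [_] /=; rewrite /closed_strip/= !in_itv/= => /andP[sy ys].
  by apply/andP; split; lra.
Qed.

Let rectangle_le (w1 w2 : R * R -> R) a b s t : a <= b -> s <= t ->
  continuous w1 -> continuous w2 ->
  (forall p, rectangle a b s t p -> w1 p <= w2 p) ->
  (\int[lebp]_(p in rectangle a b s t) (w1 p)%:E <=
   \int[lebp]_(p in rectangle a b s t) (w2 p)%:E)%E.
Proof.
move=> ab st w1c w2c w12; apply: le_integral.
- exact: measurable_rectangle.
- exact: rectangle_integrable.
- exact: rectangle_integrable.
- by move=> p /set_mem Rp; rewrite lee_fin w12.
Qed.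

Let clip_open_cont (w : R * R -> R) s : 0 < s -> s < 1 / 2 ->
  (forall p, open_strip p -> {for p, continuous w}) ->
  continuous (w \o clip_strip s (1 - s)).
Proof.
move=> s0 s1 wc p; apply: continuous_comp; first exact: clip_strip_continuous.
apply: wc; have := @clip_bounds _ s (1 - s) p.2; rewrite /open_strip/=.
by move=> /(_ ltac:(lra)) /andP[? ?]; apply/andP; split; lra.
Qed.

Let clip_open (s x y : R) : 0 < s -> s <= y <= 1 - s -> open_strip (x, y).
Proof. by move=> s0 /andP[sy ys]; apply/andP => /=; split; lra. Qed.

Let slice_cont1 (w : R * R -> R) y : continuous w -> continuous (fun x => w (x, y)).
Proof.
move=> wc x; apply: (@continuous_comp _ _ _ (fun x => (x, y)) w); last exact: wc.
by apply: continuous_pair => t; [exact: cvg_id|exact: cvg_cst].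
Qed.

Let slice_cont2 (w : R * R -> R) x : continuous w -> continuous (fun y => w (x, y)).
Proof.
move=> wc y; apply: (@continuous_comp _ _ _ (fun y => (x, y)) w); last exact: wc.
by apply: continuous_pair => t; [exact: cvg_cst|exact: cvg_id].
Qed.

Let ftc (w dw : R -> R) (a b : R) : a < b -> continuous dw ->
  (forall x, a <= x <= b -> is_derive x 1 w (dw x)) ->
  (\int[leb]_(x in `[a, b]) (dw x)%:E = (w b - w a)%:E)%E.
Proof.
move=> ab dwc wd; rewrite (@continuous_FTC2 _ dw w a b)//.
- exact: continuous_subspaceT.
- have wc := within_derive_continuous wd.
  have [wc1 wca wcb] := (continuous_within_itvP _ ab).1 wc.
  by split => // x; rewrite in_itv/= => /andP[ax xb];
    have := wd x; rewrite !ltW// => /(_ isT) h; exact: ex_derive.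
- move=> x; rewrite in_itv/= => /andP[ax xb]; have := wd x.
  by rewrite !ltW// => /(_ isT) h; rewrite derive1E; exact: derive_val.
Qed.

(** The divergence theorem on a rectangle slightly inside the strip, where [u] is
    twice differentiable; [e] bounds the flux through the horizontal sides. *)
Let flux_bound (a b s e : R) : a < b -> 0 < s -> s < 1 / 2 ->
  (forall x, a <= x <= b -> `|G (x, s)| <= e /\ `|G (x, 1 - s)| <= e) ->
  (\int[leb]_(y in `[s, (1 - s)%R]) ((F \o clip_strip s (1 - s)) (b, y)
      - (F \o clip_strip s (1 - s)) (a, y))%:E
   - (2 * e * (b - a))%:E <= M)%E.
Proof.
move=> ab s0 s1 Ge; have s2 : s < 1 - s by lra.
pose cl := clip_strip s (1 - s).
have clE x y : s <= y <= 1 - s -> cl (x, y) = (x, y) by exact: clip_strip_id.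
have dFc : continuous (dF \o cl) by exact: clip_open_cont dF_cont.
have dGc : continuous (dG \o cl) by exact: clip_open_cont dG_cont.
have FE : (\int[lebp]_(p in rectangle a b s (1 - s)) ((dF \o cl) p)%:E =
    \int[leb]_(y in `[s, (1 - s)%R]) ((F \o cl) (b, y) - (F \o cl) (a, y))%:E)%E.
  rewrite (rectangle_integral21 dFc (ltW ab) (ltW s2)).
  apply: eq_integral => y; rewrite inE/= in_itv/= => ys.
  apply: (ftc (w := fun x => (F \o cl) (x, y)) ab (slice_cont1 (y := y) dFc)) => x _.
  rewrite /= clE//; have := F_derive (clip_open x s0 ys).
  by under eq_fun do rewrite -(clE _ _ ys).
have GE : ((- (2 * e * (b - a)))%:E <=
    \int[lebp]_(p in rectangle a b s (1 - s)) ((dG \o cl) p)%:E)%E.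
  rewrite (rectangle_integral12 dGc (ltW ab) (ltW s2)).
  have -> : (- (2 * e * (b - a)))%:E = (\int[leb]_(x in `[a, b]) (- (2 * e))%:E)%E.
    rewrite integral_cst//= lebesgue_measure_itv/= lte_fin ab -EFinB -EFinM.
    by congr EFin; ring.
  have -> : (\int[leb]_(x in `[a, b]) \int[leb]_(y in `[s, (1 - s)%R]) ((dG \o cl) (x, y))%:E
      = \int[leb]_(x in `[a, b]) ((G \o cl) (x, 1 - s) - (G \o cl) (x, s))%:E)%E.
    apply: eq_integral => x _.
    transitivity (G (x, 1 - s) - G (x, s))%:E; last first.
      by rewrite /= !clE ?lexx ?(ltW s2).
    apply: (ftc (w := fun y => G (x, y)) s2 (slice_cont2 (x := x) dGc)) => y ys.
    by rewrite /= clE//; exact: G_derive (clip_open x s0 ys).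
  have Gc : continuous (G \o cl) by exact: clip_open_cont G_cont.
  apply: le_integral => //.
  - by apply: continuous_integrable => x; exact: cvg_cst.
  - apply: continuous_integrable => x; apply: cvgB.
      exact: (slice_cont1 (y := 1 - s) Gc).
    exact: (slice_cont1 (y := s) Gc).
  - move=> x; rewrite inE/= in_itv/= => /Ge[G0 G1]; rewrite lee_fin !clE; last 2 first.
    + by rewrite lexx ltW.
    + by rewrite lexx ltW.
    by move: G0 G1; rewrite !ler_norml => /andP[? ?] /andP[? ?]; lra.
rewrite -EFinN; apply: (@le_trans _ _
  (\int[lebp]_(p in rectangle a b s (1 - s)) `|zc p|%:E)%E); last first.
  by apply: strip_ge_rectangle; lra.
apply: (@le_trans _ _ (\int[lebp]_(p in rectangle a b s (1 - s))
    ((dF \o cl) p + (dG \o cl) p)%:E)%E); last first.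
  apply: rectangle_le; [exact: ltW|exact: ltW| | |].
  - by move=> p; apply: cvgD; [exact: dFc|exact: dGc].
  - by move=> p; apply: cvg_norm; exact: zc_cont.
  - move=> [x y] [_] /=; rewrite in_itv/= => ys.
    have op := clip_open x s0 ys.
    rewrite clE// zc_id; last exact: open_closed.
    exact: le_trans (flux_le op) (ler_norm _).
under [leRHS]eq_integral do rewrite EFinD.
rewrite integralD//; [|exact: measurable_rectangle|exact: rectangle_integrable dFc (ltW ab) (ltW s2)
  |exact: rectangle_integrable dGc (ltW ab) (ltW s2)].
by rewrite FE leeD2l.
Qed.

Let uc := u \o clip_strip 0 1.

Let uc01 p : 0 <= uc p <= 1.
Proof. by apply: u01; apply: clip_bounds; exact: ler01. Qed.

Let ucE x y : 0 <= y <= 1 -> uc (x, y) = u (x, y).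
Proof. by move=> y01; rewrite /uc /= clip_strip_id. Qed.

Let comp_slice_cont (h : R -> R) x : continuous h -> continuous (fun y => h (uc (x, y))).
Proof.
move=> hc; apply: (slice_cont2 (w := h \o uc)) => p.
by apply: continuous_comp; [exact: u_clip_cont|exact: hc].
Qed.

(** The flux [phi (u) d1 u] need not be small at any given abscissa.  With [H] a
    primitive of [phi], its mean over a window of width one is the increment of
    [H (u)], which tends to [0] at both ends. *)
Section Truncation.
Variable H : R -> R.
Hypothesis Hd : forall s : R, is_derive s 1 H (phi s).

Let H_cont : continuous H.
Proof. by move=> s; exact: is_derive_continuous (Hd s). Qed.

(** [F (b, y) - F (a, y)] with the derivatives of [u] replaced by their means over
    the windows that contain [a] and [b]: only values of [u] are left. *)
Let Theta (N a b y : R) :=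
  (H (uc (N + 1, y)) - H (uc (N, y))) - (H (uc (- N - 1 + 1, y)) - H (uc (- N - 1, y)))
  + (B (uc (a, y)) - B (uc (b, y))).

Let Theta_cont N a b : continuous (Theta N a b).
Proof.
move=> y; apply: cvgD; last by apply: cvgB; exact: comp_slice_cont B_cont y.
by apply: cvgB; apply: cvgB; exact: comp_slice_cont H_cont y.
Qed.

Let hflux s (p : R * R) := ((fun p => phi (u p) * d1 u p) \o clip_strip s (1 - s)) p.

Let hflux_cont s : 0 < s -> s < 1 / 2 -> continuous (hflux s).
Proof. by move=> s0 s1; exact: clip_open_cont phid1_cont. Qed.

(** The sign of [k] selects an estimate of the flux from below, for the right end,
    or from above, for the left end. *)
Let slice_choice (k N s e : R) : 0 < s -> s < 1 / 2 -> 0 < e ->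
  exists2 b, N <= b <= N + 1 &
    (\int[leb]_(y in `[s, (1 - s)%R]) (k * (H (uc (N + 1, y)) - H (uc (N, y))))%:E - e%:E
     <= \int[leb]_(y in `[s, (1 - s)%R]) (k * hflux s (b, y))%:E)%E.
Proof.
move=> s0 s1 e0; have s2 : s < 1 - s by lra.
have N1 : N < N + 1 by lra.
have wc : continuous (fun p => k * hflux s p).
  by move=> p; apply: cvgM; [exact: cvg_cst|exact: hflux_cont].
have [b bN bP] := mean_slice N wc (ltW s2) e0.
exists b => //; move: bP; congr (_ - _ <= _)%E.
rewrite (rectangle_integral21 wc (ltW N1) (ltW s2)).
apply: eq_integral => y; rewrite inE/= in_itv/= => ys.
have y01 := band_sub01 s0 ys.
rewrite !ucE// mulrBr.
apply: (ftc (w := fun x => k * H (u (x, y))) N1 (slice_cont1 (y := y) wc)) => x _.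
rewrite /hflux /= clip_strip_id//.
have [ud _] := @u_part_d [::] x y isT (clip_open x s0 ys).
exact: (is_derive_mull _ (@is_derive1_comp _ H (fun x => u (x, y)) _ _ _ (Hd _) ud)).
Qed.

Let truncated_bound (n : nat) : exists t : R * R * R, let: (s, a, b) := t in
  [/\ 0 < s < n.+1%:R^-1, s < 1 / 2, a <= - n%:R, n%:R <= b &
    ((\int[leb]_(y in `[s, (1 - s)%R]) (Theta n.+1%:R a b y)%:E) - (n.+1%:R^-1)%:E <= M)%E].
Proof.
pose N : R := n.+1%:R; have N1 : 1 <= N by rewrite /N ler1n.
pose k := N^-1; have k0 : 0 < k by rewrite invr_gt0; lra.
(* Half of the tolerance [k] is spent on the two slices, [e] each, and half on
   the horizontal sides, of length at most [2 (N + 1)]. *)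
pose e := k / 4; have e0 : 0 < e by rewrite divr_gt0.
pose e' := k / (8 * (N + 1)); have e'0 : 0 < e' by rewrite divr_gt0// mulr_gt0//; lra.
have [s [s0 sn s12 sG]] : exists s, [/\ 0 < s, s < k, s < 1 / 2 &
    forall x, - (N + 1) <= x <= N + 1 -> `|G (x, s)| <= e' /\ `|G (x, 1 - s)| <= e'].
  have fl := flux_small (N + 1) e'0.
  near (0 : R)^'+ => s; exists s; split; near: s => //.
  - exact: nbhs_right_gt.
  - exact: nbhs_right_lt.
  - by apply: nbhs_right_lt; rewrite divr_gt0.
have s2 : s < 1 - s by lra.
have [b bN wb] := slice_choice 1 N s0 s12 e0.
have [a aN wa] := slice_choice (-1) (- N - 1) s0 s12 e0.
have /andP[b1 b2] := bN; have /andP[a1 a2] := aN.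
have nN : (n%:R : R) <= N by rewrite /N ler_nat.
exists (s, a, b); split => //; [by rewrite s0|lra|lra|].
have ab : a < b by lra.
have ba : b - a <= 2 * (N + 1) by lra.
have cleft x : a <= x <= b -> `|G (x, s)| <= e' /\ `|G (x, 1 - s)| <= e'.
  by move=> /andP[ax xb]; apply: sG; apply/andP; split; lra.
apply: le_trans (flux_bound ab s0 s12 cleft).
have hc x : continuous (fun y => hflux s (x, y)).
  exact: slice_cont2 (hflux_cont s0 s12).
have kc x (m : R) : continuous (fun y => m * hflux s (x, y)).
  by move=> y; apply: cvgM; [exact: cvg_cst|exact: hc].
have Hc x m : continuous (fun y => m * (H (uc (x + 1, y)) - H (uc (x, y)))).
  move=> y; apply: cvgM; first exact: cvg_cst.
  by apply: cvgB; exact: comp_slice_cont H_cont y.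
have Bc : continuous (fun y => B (uc (a, y)) - B (uc (b, y))).
  by move=> y; apply: cvgB; exact: comp_slice_cont B_cont y.
have ke : 2 * e' * (b - a) + 2 * e <= k.
  have : 2 * e' * (b - a) <= 2 * e' * (2 * (N + 1)).
    by apply: ler_wpM2l ba; rewrite mulr_ge0// ltW.
  have -> : 2 * e' * (2 * (N + 1)) = k / 2 by rewrite /e'; field; rewrite gt_eqF//; lra.
  by rewrite /e; lra.
apply: le_trans (le_trans _ (integral_sum_transfer (Hc N 1) (Hc (- N - 1) (-1))
  (kc b 1) (kc a (-1)) Bc wb wa ke)) _.
  rewrite le_eqVlt; apply/orP; left; apply/eqP; congr (_ - _)%E.
  by apply: eq_integral => y _; congr EFin; rewrite /Theta -/N; ring.
rewrite le_eqVlt; apply/orP; left; apply/eqP; congr (_ - _)%E.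
apply: eq_integral => y; rewrite inE/= in_itv/= => ys.
have y01 := band_sub01 s0 ys.
by congr EFin; rewrite !ucE// /hflux /F /= !clip_strip_id//; ring.
Unshelve. all: by end_near. Qed.

Let bounded_on01 (h : R -> R) : continuous h ->
  exists C, forall s, 0 <= s <= 1 -> `|h s| <= C.
Proof.
move=> hc; have [|m _ mP] := @EVT_max R (fun s => `|h s|) 0 1 ler01.
  by apply: continuous_subspaceT => s; apply: cvg_norm; exact: hc.
by exists `|h m| => s s01; apply: mP; rewrite in_itv.
Qed.

Let Theta_bounded : exists C, forall N a b y, `|Theta N a b y| <= C.
Proof.
have [CH HP] := bounded_on01 H_cont; have [CB BP] := bounded_on01 B_cont.
exists (4 * CH + 2 * CB) => N a b y.
have h x := HP _ (uc01 (x, y)); have k x := BP _ (uc01 (x, y)).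
have := h (N + 1); have := h N; have := h (- N - 1 + 1); have := h (- N - 1).
have := k a; have := k b; rewrite /Theta !ler_norml.
move=> /andP[? ?] /andP[? ?] /andP[? ?] /andP[? ?] /andP[? ?] /andP[? ?].
by apply/andP; split; lra.
Qed.

Let uc_cvgy (b : nat -> R) y : 0 < y < 1 -> (forall n, n%:R <= b n) ->
  (fun n => uc (b n, y)) @ \oo --> (1 : R).
Proof.
move=> /andP[y0 y1] nb.
have y01 : 0 <= y <= 1 by apply/andP; split; exact: ltW.
have by_ : b @ \oo --> +oo.
  by apply: (ger_cvgy _ (@cvgr_idn R)); near=> n; exact: nb.
under eq_fun do rewrite ucE//.
exact: (cvg_comp b (fun x => u (x, y)) by_ (u_lim y01).2).
Unshelve. all: by end_near. Qed.

Let uc_cvgNy (a : nat -> R) y : 0 < y < 1 -> (forall n, a n <= - n%:R) ->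
  (fun n => uc (a n, y)) @ \oo --> (0 : R).
Proof.
move=> /andP[y0 y1] na.
have y01 : 0 <= y <= 1 by apply/andP; split; exact: ltW.
have ay : a @ \oo --> -oo.
  apply/cvgNry; apply: (ger_cvgy _ (@cvgr_idn R)); near=> n.
  by rewrite lerNr; exact: na.
under eq_fun do rewrite ucE//.
exact: (cvg_comp a (fun x => u (x, y)) ay (u_lim y01).1).
Unshelve. all: by end_near. Qed.

(** [Theta] is bounded, since [u] is, and it tends to [B 0 - B 1] on each line:
    dominated convergence. *)
Lemma strip_limit : ((B 0 - B 1)%:E <= M)%E.
Proof.
have /choice[t tP] := truncated_bound.
pose s n := (t n).1.1; pose a n := (t n).1.2; pose b n := (t n).2.
have {tP}P n : [/\ 0 < s n < n.+1%:R^-1, s n < 1 / 2, a n <= - n%:R, n%:R <= b n &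
    ((\int[leb]_(y in `[s n, (1 - s n)%R]) (Theta n.+1%:R (a n) (b n) y)%:E)
      - (n.+1%:R^-1)%:E <= M)%E].
  by have := tP n; rewrite /s /a /b; case: (t n) => [[]].
pose D : set (measurableTypeR R) := `]0, 1[%classic.
have mD : measurable D by exact: measurable_itv.
pose Y n : set (measurableTypeR R) := `[s n, (1 - s n)]%classic.
have mY n : measurable (Y n) by exact: measurable_itv.
pose g n (y : R) := Theta n.+1%:R (a n) (b n) y.
pose fn n : R -> \bar R := (EFin \o g n) \_ (Y n).
have gY n : (\int[leb]_(y in D) fn n y = \int[leb]_(y in Y n) (g n y)%:E)%E.
  rewrite /fn -integral_mkcondr; congr (integral _ _ _).
  apply/setIidPr => y; rewrite /D /Y /= !in_itv/= => /andP[sy ys].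
  by have [/andP[sn0 _] _ _ _ _] := P n; apply/andP; split; lra.
have [C CP] := Theta_bounded.
have mfn n : measurable_fun D (fn n).
  have ig : leb.-integrable (Y n) (EFin \o g n).
    by apply: continuous_integrable; exact: Theta_cont.
  move/(integrable_mkcond _ (mY n)) : ig => /measurable_int h.
  exact: (measurable_funS measurableT (@subsetT _ _) h).
have fn_cvg y : D y -> fn ^~ y @ \oo --> (B 0 - B 1)%:E.
  rewrite /D /= in_itv/= => y01; have /andP[y0 y1] := y01.
  have gcvg : g ^~ y @ \oo --> B 0 - B 1.
    have lb (x : nat -> R) : (forall n, n%:R <= x n) ->
        (fun n => H (uc (x n, y))) @ \oo --> H 1.
      by move=> nx; apply: continuous_cvg; [exact: H_cont|exact: uc_cvgy].
    have la (x : nat -> R) : (forall n, x n <= - n%:R) ->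
        (fun n => H (uc (x n, y))) @ \oo --> H 0.
      by move=> nx; apply: continuous_cvg; [exact: H_cont|exact: uc_cvgNy].
    have nS n : (n%:R : R) <= n.+1%:R by rewrite ler_nat.
    rewrite (_ : B 0 - B 1 = (H 1 - H 1) - (H 0 - H 0) + (B 0 - B 1)); last by ring.
    apply: cvgD; last apply: cvgB.
    - apply: cvgB; apply: cvgB.
      + by apply: lb => n; have := nS n; lra.
      + exact: lb.
      + by apply: la => n; have := nS n; lra.
      + by apply: la => n; have := nS n; lra.
    - apply: continuous_cvg; [exact: B_cont|apply: uc_cvgNy => // n].
      by have [] := P n.
    - apply: continuous_cvg; [exact: B_cont|apply: uc_cvgy => // n].
      by have [] := P n.
  have gcvgE : (fun n => (g n y)%:E) @ \oo --> (B 0 - B 1)%:E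
    by apply: cvg_EFin; [exact: nearW|exact: gcvg].
  have y1' : 0 < 1 - y by lra.
  apply: cvg_trans gcvgE; apply: near_eq_cvg; near=> n.
  have [/andP[sn0 sn1] _ _ _ _] := P n.
  have h1 : n.+1%:R^-1 < y by near: n; exact: (near_infty_natSinv_lt (PosNum y0)).
  have h2 : n.+1%:R^-1 < 1 - y by near: n; exact: (near_infty_natSinv_lt (PosNum y1')).
  rewrite /fn patchE ifT// inE /Y/= in_itv/= (ltW (lt_trans sn1 h1))/=.
  by rewrite lerBrDr -lerBrDl ltW// (lt_trans sn1 h2).
have fn_le y n : D y -> (`|fn n y| <= cst C%:E y)%E.
  move=> _; rewrite /fn patchE; case: ifP => _ /=; first by rewrite lee_fin CP.
  by rewrite normr0 lee_fin (le_trans _ (CP 0 0 0 0)).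
have iC : leb.-integrable D (cst C%:E).
  apply/integrableP; split; first exact: measurable_cst.
  by rewrite integral_cst//= lebesgue_measure_itv/= lte_fin ltr01 -EFinB -EFinM ltry.
have [_ _ dc] := dominated_convergence mD mfn (measurable_cst _)
  (aeW _ fn_cvg) iC (aeW _ fn_le).
have LE : (\int[leb]_(y in D) (B 0 - B 1)%:E = (B 0 - B 1)%:E)%E.
  by rewrite integral_cst//= lebesgue_measure_itv/= lte_fin ltr01 -EFinB -EFinM subr0 mulr1.
rewrite LE in dc.
have hc : (fun n => (n.+1%:R^-1 : R)%:E) @ \oo --> 0%:E.
  by apply: cvg_EFin; [exact: nearW|exact: cvg_harmonic].
have Lfin : ((B 0 - B 1)%:E +? - 0%:E)%E by [].
(* The tolerance vanishes in the limit. *)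
have lim := @cvgeB _ _ eventually_filter R _ _ _ _ Lfin dc hc; rewrite sube0 in lim.
rewrite -(cvg_lim _ lim)//; apply: lime_le.
  by apply/cvg_ex; eexists; exact: lim.
by near=> n; rewrite /= gY; have [] := P n.
Unshelve. all: by end_near. Qed.

End Truncation.

Theorem strip_cost_ge : ((B 0 - B 1)%:E <=
  \int[lebp]_(p in closed_strip) `|z p|%:E)%E.
Proof.
by have [H [_ Hd]] := antiderivative phi_cont; exact: strip_limit Hd.
Qed.

End Strip.

(** * Comparison of the two costs *)

Section Rate.
Context {R : realType}.

(** The positive root of the characteristic equation.  The bounds keep it away from
    [0] and infinity as long as [k] is. *)
Lemma decay_rate_exists (c k : R) : 0 < k -> exists lam,
  [/\ 0 < lam, lam ^+ 2 - c * lam = k, lam <= `|c| + k + 1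
    & lam^-1 <= (2 * `|c| + k + 1) / k].
Proof.
move=> k0; have d0 : 0 <= c ^+ 2 + 4 * k by rewrite addr_ge0 ?sqr_ge0 ?mulr_ge0// ltW.
set q := Num.sqrt (c ^+ 2 + 4 * k).
have q2 : q ^+ 2 = c ^+ 2 + 4 * k by rewrite sqr_sqrtr.
have q0 : 0 <= q := sqrtr_ge0 _.
have cq : `|c| < q by rewrite -(ltr_pXn2r (ltn0Sn 1)) ?nnegrE// real_normK ?num_real// q2; lra.
have [cN cP] : - `|c| <= c /\ c <= `|c| by split; [have := lerNnormlW (lexx `|c|)|exact: ler_norm].
have c0 := normr_ge0 c.
have c2 : `|c| ^+ 2 = c ^+ 2 by rewrite real_normK ?num_real.
have qle : q <= `|c| + 2 * k + 2.
  rewrite leNgt; apply/negP => ql.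
  have : (`|c| + 2 * k + 2) ^+ 2 < q ^+ 2 by rewrite ltr_pXn2r// nnegrE; lra.
  rewrite q2 -c2; nra.
have lam_gt0 : 0 < (c + q) / 2 by lra.
have lamE : ((c + q) / 2) ^+ 2 - c * ((c + q) / 2) = k by rewrite expr2 in q2 *; nra.
have lamle : (c + q) / 2 <= `|c| + k + 1 by lra.
exists ((c + q) / 2); split => //.
rewrite ler_pdivlMr// ler_pdivrMl//; move: lamE lamle lam_gt0.
set lam := (c + q) / 2; nra.
Qed.

End Rate.

Section Comparison.
Context {R : realType}.
Variables (f : R -> R) (c : R) (u z : R * R -> R).
Notation cost := (\int[@lebesgue_measure R \x @lebesgue_measure R]_(p in closed_strip)
  `|z p|%:E)%E.
Hypothesis fmono : monostable f.
Hypothesis u01 : forall p, closed_strip p -> 0 <= u p <= 1.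
Hypothesis z0 : forall p, closed_strip p -> 0 <= z p.
Hypothesis z_smooth : smooth_source z.
Hypothesis u_sol : strip_solution f c z u.
Hypothesis u_lim : front_limits u.

(** If the front reaches [0], its point mass exceeds the value of the calibration by
    at most [(lam + |c|) (1 - s1)]; otherwise its source is its whole cost, and
    [L (1 - s1) / lam] bounds that in either case. *)
Lemma C_min_le_cut s1 lam L : 0 < s1 < 1 -> 0 < lam ->
  lam ^+ 2 - c * lam = chord_slope f s1 ->
  (forall x y, 0 <= x <= 1 -> 0 <= y <= 1 -> `|f x - f y| <= L * `|x - y|) ->
  (C_min f c <= cost + ((lam + `|c| + L / lam) * (1 - s1))%:E)%E.
Proof.
move=> s01 lam0 lamE fL; have [V [W VW]] := reversed_front_exists fmono s01 lam0 lamE.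
have mass := front_source_mass fmono s01 lam0 VW fL.
have /andP[_ s1_lt1] := s01.
case: (reversed_front_dichotomy s01 VW) => [[T T0 VT]|Vpos].
  have [phi [dphi [B [dB [cal Bge]]]]] := front_calibration fmono s01 lam0 VW T0 VT.
  have costB := strip_cost_ge cal u01 z0 z_smooth u_sol u_lim.
  apply: le_trans (C_min_front_hit fmono s01 lam0 VW T0 VT) _.
  apply: le_trans (leeD (lexx _) mass) _.
  apply: le_trans (leeD costB (lexx _)).
  rewrite -!EFinD lee_fin -mulrA [(_ / lam)]mulrC; nra.
apply: le_trans (C_min_front_positive fmono s01 lam0 VW Vpos) _.
apply: le_trans mass _; rewrite -[leLHS]add0e; apply: leeD.
  by apply: integral_ge0 => p _; rewrite lee_fin.
rewrite lee_fin mulrDl [_ * (1 - s1) / lam]mulrAC lerDr.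
by apply: mulr_ge0; [apply: addr_ge0 => //|rewrite subr_ge0]; exact: ltW.
Qed.

End Comparison.

Theorem proposition6p1 (R : realType) (f : R -> R) (cstar c : R)
    (u z : R * R -> R) :
  monostable f ->
  is_critical_speed f cstar ->
  cstar < c ->
  (forall p, closed_strip p -> 0 <= u p <= 1) ->
  (forall p, closed_strip p -> 0 <= z p) ->
  smooth_source z ->
  strip_solution f c z u ->
  front_limits u ->
  (C_min f c <=
   \int[@lebesgue_measure R \x @lebesgue_measure R]_(p in closed_strip) `|z p|%:E)%E.
Proof.
move=> fmono _ _ u01 z0 z_smooth u_sol u_lim.
have [L L0 fL] := monostable_lipschitz fmono.
have f1 : f 1 = 0 by case: fmono.
set m := `|c|; have m0 : 0 <= m := normr_ge0 c.
(* By concavity the slope of the chord is at least [k] for [s1 >= 1 / 2], and it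
   is at most [L]; [K] then bounds the error divided by [d = 1 - s1]. *)
pose k := 2 * f (1 / 2).
have k_gt0 : 0 < k by rewrite mulr_gt0// monostable_gt0//; apply/andP; split; lra.
pose K := (m + L + 1) + m + L * ((2 * m + L + 1) / k).
have M0 : 0 <= (2 * m + L + 1) / k by apply: divr_ge0; [lra|exact: ltW].
have K0 : 0 <= K by apply: addr_ge0; [lra|exact: mulr_ge0].
apply/lee_addgt0Pr => e e0.
pose d := Num.min (1 / 2) (e / (K + 1)).
have K1 : 0 < K + 1 by lra.
have d_gt0 : 0 < d by rewrite /d lt_min; apply/andP; split; [lra|exact: divr_gt0].
have d_half : d <= 1 / 2 by rewrite /d ge_min lexx.
have Kd : K * d <= e.
  have : d <= e / (K + 1) by rewrite /d ge_min lexx orbT.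
  rewrite ler_pdivlMr//; nra.
have s01 : 0 < 1 - d < 1 by apply/andP; split; lra.
have dE : 1 - (1 - d) = d by ring.
have kge : k <= chord_slope f (1 - d).
  rewrite /chord_slope dE ler_pdivlMr// /k.
  have := @monostable_chord1 _ f fmono (1 / 2) (1 - d); lra.
have kle : chord_slope f (1 - d) <= L.
  rewrite /chord_slope dE ler_pdivrMr//.
  have := fL (1 - d) 1; rewrite f1 subr0.
  have -> : 1 - d - 1 = - d by ring.
  rewrite normrN (gtr0_norm d_gt0) => h.
  by apply: le_trans (ler_norm _) (h _ _); apply/andP; split; lra.
have slope0 := lt_le_trans k_gt0 kge.
have [lam [lam0 lamE lamle ilam]] := decay_rate_exists c slope0.
apply: le_trans (C_min_le_cut fmono u01 z0 z_smooth u_sol u_lim s01 lam0 lamE fL) _.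
apply: leeD => //; rewrite lee_fin dE; apply: le_trans Kd.
rewrite -/m in lamle ilam *; apply: ler_wpM2r; first exact: ltW.
apply: lerD; first by lra.
apply: ler_wpM2l => //; apply: le_trans ilam _; apply: ler_pM; last by rewrite lef_pV2.
- by lra.
- by rewrite invr_ge0 ltW.
- by lra.
Qed.
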